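(* Let $(X,T)$ be a topological dynamical system satisfying the specification property, and let $\mathcal{F}=\{f_n\}_{n\ge1}$ and $\Phi=\{\varphi_n\}_{n\ge1}$ be two asymptotically additive potentials on $X$. Then for each $\alpha\in[\eta(\Phi),\beta(\Phi)]$, $$\Lambda_{\mathcal{F}\mid\Phi}(\alpha)=\sup_{x\in K_\Phi(\alpha)}\limsup_{n\to\infty}\frac1n f_n(x)=\sup\Big\{\mathcal{F}_*(\mu):\mu\in\bigcup_{x\in K_\Phi(\alpha)}\mathcal{V}(x)\Big\}.$$
   Context: $X$ is a compact metric space with metric $d$ and $T:X\to X$ is continuous. $\mathcal{M}_T$ denotes the set of $T$-invariant Borel probability measures on $X$. For $f\in C(X)$, $S_nf=\sum_{i=0}^{n-1}f\circ T^i$. A sequence $\mathcal{F}=\{f_n\}_{n\ge1}\subset C(X)$ is an asymptotically additive potential (AAP) if for every $\xi>0$ there is $f_\xi\in C(X)$ with $\limsup_{n\to\infty}\frac1n\|f_n-S_nf_\xi\|_\infty<\xi$; for $\mu\in\mathcal{M}_T$, $\mathcal{F}_*(\mu)=\lim_{n\to\infty}\frac1n\int f_n\,d\mu$ (this limit exists). $\beta(\Phi)=\max_{\mu\in\mathcal{M}_T}\Phi_*(\mu)$, $\eta(\Phi)=\min_{\mu\in\mathcal{M}_T}\Phi_*(\mu)$, $\Lambda_{\mathcal{F}\mid\Phi}(\alpha)=\sup\{\mathcal{F}_*(\mu):\mu\in\mathcal{M}_T,\ \Phi_*(\mu)=\alpha\}$. The level set is $K_\Phi(\alpha)=\{x\in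 X:\lim_{n\to\infty}\frac1n\varphi_n(x)=\alpha\}$. For $x\in X$, $\mathcal{V}(x)$ is the set of weak$^*$ limit points of the empirical measures $\delta_{x,n}=\frac1n\sum_{i=0}^{n-1}\delta_{T^ix}$. $(X,T)$ has the specification property if for every $\epsilon>0$ there is an integer $m(\epsilon)$ such that for any finite collection of intervals $[a_j,b_j]\subset\mathbb{N}$, $j=1,\dots,k$, with $a_{j+1}-b_j\ge m(\epsilon)$ for $j=1,\dots,k-1$, and any $x_1,\dots,x_k\in X$, there is $x\in X$ with $d(T^{p+a_j}x,T^px_j)<\epsilon$ for all $p=0,1,\dots,b_j-a_j$ and all $j=1,\dots,k$. *)

(* Defs.v *)
From HB Require Import structures.
From mathcomp Require Import all_boot all_order all_algebra.
From mathcomp Require Import all_classical all_reals all_analysis.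
Set Implicit Arguments. Unset Strict Implicit. Unset Printing Implicit Defensive.
Import Order.TTheory GRing.Theory Num.Theory.
Import numFieldNormedType.Exports.
Local Open Scope classical_set_scope.
Local Open Scope ring_scope.

Section Defs.
Context {R : realType} {X : pseudoPMetricType R}.

Definition BorelX := g_sigma_algebraType (@open X).

Definition invariant_measures (T : X -> X) : set (probability BorelX R) :=
  [set mu | forall A : set BorelX, measurable A ->
            mu (T @^-1` A) = mu A].

Definition birkhoff (T : X -> X) (g : X -> R) (n : nat) (x : X) : R :=
  \sum_(i < n) g (iter i T x).

Definition sup_norm (h : X -> R) : R := sup [set `|h x| | x in [set: X]].

(* Asymptotically additive potential (indices n >= 1 are the relevant ones). *)
Definition AAP (T : X -> X) (F : nat -> X -> R) : Prop :=
  (forall n, (0 < n)%N -> continuous (F n)) /\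
  forall xi : R, 0 < xi -> exists g : X -> R, continuous g /\
    (limn_esup (fun n : nat =>
       ((n%:R)^-1 * sup_norm (fun x => F n x - birkhoff T g n x))%:E)
     < xi%:E)%E.

Definition Fstar (F : nat -> X -> R) (mu : probability BorelX R) : R :=
  limn (fun n : nat => (n%:R)^-1 * Rintegral mu [set: BorelX] (F n)).

Definition beta_pot (T : X -> X) (Phi : nat -> X -> R) : \bar R :=
  ereal_sup [set (Fstar Phi mu)%:E | mu in invariant_measures T].
Definition eta_pot (T : X -> X) (Phi : nat -> X -> R) : \bar R :=
  ereal_inf [set (Fstar Phi mu)%:E | mu in invariant_measures T].

Definition Lambda (T : X -> X) (F Phi : nat -> X -> R) (alpha : R) : \bar R :=
  ereal_sup [set (Fstar F mu)%:E |
             mu in [set mu | invariant_measures T mu /\ Fstar Phi mu = alpha]].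

Definition level_set (Phi : nat -> X -> R) (alpha : R) : set X :=
  [set x | (fun n : nat => (n%:R)^-1 * Phi n x) @ \oo --> alpha].

(* V(x): weak-* limit points of the empirical measures
   delta_{x,n} = (1/n) sum_{i<n} delta_{T^i x}; here
   int g d(delta_{x,n}) = (1/n) S_n g (x). *)
Definition limit_points (T : X -> X) (x : X) : set (probability BorelX R) :=
  [set mu | exists phi : nat -> nat, (forall k, (phi k < phi k.+1)%N) /\
     forall g : X -> R, continuous g ->
       (fun k => ((phi k)%:R)^-1 * birkhoff T g (phi k) x) @ \oo -->
         Rintegral mu [set: BorelX] g].

Definition specification (T : X -> X) : Prop :=
  forall eps : R, 0 < eps -> exists m : nat,
    forall (k : nat) (a b : nat -> nat) (xs : nat -> X),
      (forall j, (j < k)%N -> (a j <= b j)%N) ->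
      (forall j, (j.+1 < k)%N -> (b j + m <= a j.+1)%N) ->
      exists x : X, forall j, (j < k)%N -> forall p, (p <= b j - a j)%N ->
        ball (iter p T (xs j)) eps (iter (p + a j) T x).

End Defs.

(* Main.v *)
(* If the averages of all continuous functions along the orbit of x converge,
   along some filter on the times, to integration against mu, then mu is
   invariant and n^-1 * psi_n(x) tends to Psi_*(mu) along the same filter for
   every asymptotically additive Psi.  Applied to a subsequence, this bounds the
   supremum over limit points by Lambda.  Applied to an ultrafilter along which
   n^-1 * f_n(x) stays above a given a < limsup, it bounds the limsup; there the
   measure comes from a Riesz representation of the ultralimit of empirical
   averages, obtained as the image of Lebesgue measure on [0, 1) under a quantile
   map.  For the converse inequalities, specification provides, for every
   invariant mu, a point x whose empirical measures converge to mu; it is built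
   without ergodic decomposition, by approximating mu by a finite average of
   orbit segments and concatenating these. *)
Require Import Defs.
From HB Require Import structures.
From mathcomp Require Import all_boot all_order all_algebra.
From mathcomp Require Import all_classical all_reals all_analysis.
From mathcomp Require Import measurable_realfun ring lra.
Set Implicit Arguments. Unset Strict Implicit. Unset Printing Implicit Defensive.
Import Order.TTheory GRing.Theory Num.Theory.
Import numFieldNormedType.Exports.
Local Open Scope classical_set_scope.
Local Open Scope ring_scope.

(** * Borel probabilities on a compact space *)

Section BoundedIntegrands.
Context (R : realType) d (S : measurableType d) (P : probability S R).

Lemma bounded_integrable (D : set S) (h : S -> R) (M : R) : measurable D ->
  measurable_fun D h -> (forall x, `|h x| <= M) -> P.-integrable D (EFin \o h).
Proof.
move=> mD mh hM; apply: measurable_bounded_integrable => //.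
  by rewrite -ge0_fin_numE// fin_num_measure.
exists M; split; first exact: num_real.
by move=> N MN x _ /=; rewrite (le_trans (hM x))// ltW.
Qed.

Lemma Rintegral_local (D : set S) (h : S -> R) (c e : R) : measurable D ->
  P.-integrable D (EFin \o h) -> (forall x, D x -> `|h x - c| <= e) ->
  `|Rintegral P D h - c * fine (P D)| <= e * fine (P D).
Proof.
move=> mD ih hc; have ic k : P.-integrable D (EFin \o (fun=> k)).
  by apply: (@bounded_integrable _ _ `|k|) => //; exact: measurable_cst.
rewrite ler_distl -mulrBl -mulrDl -!(Rintegral_cst P mD).
by apply/andP; split; apply: le_Rintegral => // x /hc; rewrite ler_distl => /andP[].
Qed.

End BoundedIntegrands.

Section BorelMeasures.
Context (R : realType) (X : pseudoPMetricType R).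
Hypothesis cX : compact [set: X].
Local Notation BX := (@BorelX R X).
Implicit Types (g : X -> R) (mu nu : probability BX R).

Lemma continuous_bounded g : continuous g ->
  exists M : R, 0 < M /\ forall x, `|g x| <= M.
Proof.
move=> cg; have cs : compact (g @` [set: X]).
  by apply: continuous_compact => //; exact: continuous_subspaceT.
have [M [Mr HM]] := @compact_bounded R R^o _ cs.
exists (`|M| + 1); split; first by rewrite ltr_wpDl.
move=> x; apply: HM; last by exists x.
by rewrite (le_lt_trans (ler_norm M))// ltrDl.
Qed.

Lemma open_measurableX (U : set X) : open U -> measurable (U : set BX).
Proof. by move=> oU; exact: sub_sigma_algebra. Qed.

Lemma continuous_measurableX g : continuous g -> measurable_fun [set: BX] g.
Proof.
move=> /continuousP cg; apply: (measurability _ (RGenOInfty.measurableE R)).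
move=> _ [_ [a ->] <-]; rewrite setTI; apply: open_measurableX.
by apply: cg; exact: interval_open.
Qed.

Lemma continuous_integrableX mu g : continuous g ->
  mu.-integrable [set: BX] (EFin \o g).
Proof.
move=> cg; have [M [_ gM]] := continuous_bounded cg.
exact: bounded_integrable (continuous_measurableX cg) gM.
Qed.

Lemma Rintegral_cst1 mu (r : R) : Rintegral mu [set: BX] (fun=> r) = r.
Proof. 
rewrite Rintegral_cst// [X in fine X](_ : _ = 1%E) ?mulr1//.
exact: (probability_setT mu).
Qed.

Lemma Rintegral_norm_le mu g (e : R) : continuous g ->
  (forall x, `|g x| <= e) -> `|Rintegral mu [set: BX] g| <= e.
Proof.
move=> cg ge; apply: le_trans (le_normr_Rintegral _ _) _ => //.
  exact: continuous_integrableX.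
rewrite -[leRHS](Rintegral_cst1 mu); apply: le_Rintegral => //.
- apply: (@continuous_integrableX mu (fun x => `|g x|)) => x.
  by apply: continuous_comp; [exact: cg|exact: norm_continuous].
- by apply: continuous_integrableX; exact: cst_continuous.
Qed.

Lemma Rintegral_dist_le mu g h (e : R) : continuous g -> continuous h ->
  (forall x, `|g x - h x| <= e) ->
  `|Rintegral mu [set: BX] g - Rintegral mu [set: BX] h| <= e.
Proof.
move=> cg ch ghe; rewrite -RintegralB//; try exact: continuous_integrableX.
apply: (@Rintegral_norm_le mu (fun x => g x - h x)) => // x.
by apply: cvgB; [exact: cg|exact: ch].
Qed.

(** Urysohn functions separating the complement of [U] from the points whose ball of radius 1/(n+1)
    stays in [U]; every point of [U] eventually belongs to the latter set. Only the uniform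
    structure is used. *)
Lemma open_approx_continuous (U : set X) : open U ->
  exists f : nat -> X -> R, [/\ forall n, continuous (f n),
    forall n x, 0 <= f n x <= 1 & forall x, f n x @[n --> \oo] --> (\1_U x : R)].
Proof.
move=> oU; pose B n := [set x : X | ball x n.+1%:R^-1 `<=` U].
have sep n : uniform_separator (~` U) (B n).
  apply: uniform_separatorW.
  exists [set xy | ball xy.1 (n.+1%:R^-1 : R) xy.2].
    exact: (entourage_ball X (PosNum _)).
  apply/seteqP; split => // -[x y] [[/= nUx By] xy].
  by apply: nUx; apply: By; apply: ball_sym.
exists (fun n => Urysohn (~` U) (B n)); split.
- by move=> n; exact: Urysohn_continuous.
- move=> n x; have : `[0, 1]%classic (Urysohn (~` U) (B n) x : R).
    by apply: (@Urysohn_range X R (~` U) (B n)); exists x.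
  by rewrite /= in_itv.
- move=> x; rewrite indicE; have [xU|xU] := boolP (x \in U); last first.
    rewrite (_ : (fun _ => _) = fun=> 0); first exact: cvg_cst.
    apply/funext => n; apply: (@Urysohn_sub0 X R _ _ (sep n)).
    by exists x => //=; move: xU; rewrite notin_setE.
  have := oU; rewrite openE => /(_ x (set_mem xU)) /nbhs_ballP [e /= e0 He].
  apply: cvg_near_cst; near=> n.
  apply: (@Urysohn_sub1 X R _ _ (sep n)); exists x => //.
  apply: subset_trans He; apply: le_ball; apply/ltW; near: n.
  exact: near_infty_natSinv_lt (PosNum e0).
Unshelve. all: by end_near. Qed.

Lemma measure_open_lim mu (U : set X) (f : nat -> X -> R) : open U ->
  (forall n, continuous (f n)) -> (forall n x, 0 <= f n x <= 1) ->
  (forall x, f n x @[n --> \oo] --> (\1_U x : R)) ->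
  (fun n => \int[mu]_(x in [set: BX]) (f n x)%:E)%E @ \oo --> mu U.
Proof.
move=> oU cf f01 fU.
have mU := open_measurableX oU.
have := @dominated_cvg _ BX R mu setT measurableT (fun n => EFin \o f n)
  (fun x => (\1_U x)%:E) (cst 1%E).
rewrite integral_indic// setIT; apply.
- by move=> n; apply/measurable_EFinP; exact: continuous_measurableX.
- by move=> x _; apply/fine_cvgP; split; [exact: nearW|exact: fU].
- by [].
- by apply: (@continuous_integrableX mu (cst 1)) => x; exact: cst_continuous.
- by move=> n x _ /=; rewrite lee_fin ger0_norm; case/andP: (f01 n x).
Qed.

(** Open sets are stable under intersection and generate the sigma-algebra, and their measures are
    limits of integrals of continuous functions. *)
Lemma Borel_probability_unique mu nu :
  (forall g, continuous g ->
     Rintegral mu [set: BX] g = Rintegral nu [set: BX] g) ->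
  forall A : set BX, measurable A -> mu A = nu A.
Proof.
move=> H.
have Ho (U : set X) : open U -> mu U = nu U.
  move=> oU; have [f [cf f01 fU]] := open_approx_continuous oU.
  have c1 := @measure_open_lim mu U f oU cf f01 fU.
  have c2 := @measure_open_lim nu U f oU cf f01 fU.
  rewrite -(cvg_lim _ c1)// -(cvg_lim _ c2)//; congr (limn _).
  apply/funext => n.
  rewrite -[LHS]fineK; last first.
    by apply: integrable_fin_num => //; exact: continuous_integrableX (cf n).
  rewrite -[RHS]fineK; last first.
    by apply: integrable_fin_num => //; exact: continuous_integrableX (cf n).
  by congr EFin; exact: H.
apply: (@measure_unique _ R BX (@open X) (fun=> setT)) => //.
- by move=> A B; exact: openI.
- by move=> _; exact: openT.
- by apply/seteqP; split => // x _; exists 0%N.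
- by move=> _; rewrite -ge0_fin_numE// fin_num_measure.
Qed.

End BorelMeasures.

(** * Asymptotically additive potentials *)

(** Serves twice: with [Y] the dynamics, to turn invariance of sets into invariance of integrals and
    back, and with [Y] the quantile map, to construct a measure. *)
Lemma pushforward_probability (R : realType) (X : pseudoPMetricType R)
    (cX : compact [set: X]) d (S : measurableType d) (P : probability S R)
    (Y : S -> @BorelX R X) : measurable_fun [set: S] Y ->
  exists nu : probability (@BorelX R X) R,
    (forall A, nu A = P (Y @^-1` A)) /\
    forall g : X -> R, continuous g ->
      Rintegral nu [set: @BorelX R X] g = Rintegral P [set: S] (g \o Y).
Proof.
move=> mY.
pose Ym : {mfun S >-> @BorelX R X} :=
  HB.pack Y (isMeasurableFun.Build _ _ _ _ Y mY).
exists (distribution P Ym); split=> // g cg.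
have mg := continuous_measurableX cg.
have [M [_ gM]] := continuous_bounded cX cg.
congr fine; rewrite integral_pushforward//; first exact/measurable_EFinP.
rewrite preimage_setT.
have mgY : measurable_fun [set: S] ((g : @BorelX R X -> R) \o Y).
  exact: measurableT_comp.
exact: (@bounded_integrable _ _ _ P _ _ M).
Qed.

Lemma cvg_inv_nat (R : realType) : (n%:R^-1 : R) @[n --> \oo] --> (0 : R).
Proof.
rewrite -(cvg_shiftS (fun n => n%:R^-1 : R)).
exact: cvg_harmonic.
Qed.

Section AsymptoticallyAdditive.
Context (R : realType) (X : pseudoPMetricType R) (T : X -> X).
Hypothesis cX : compact [set: X].
Hypothesis cT : continuous T.
Local Notation BX := (@BorelX R X).
Local Notation "'I_[ mu ] g" := (Rintegral mu [set: BX] g)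
  (at level 10, mu at level 0, g at level 9).
Implicit Types (g : X -> R) (mu nu : probability BX R).

Lemma continuous_iter n : continuous (iter n T).
Proof.
elim: n => [|n IH] x; first exact: cvg_id.
by apply: (@continuous_comp _ _ _ (iter n T) T); [exact: IH|exact: cT].
Qed.

Lemma map_measurable : measurable_fun [set: BX] (T : BX -> BX).
Proof.
apply: (@measurability _ _ BX BX setT T (@open X) erefl) => _ [U oU <-].
rewrite setTI; apply: open_measurableX.
by move/continuousP: cT; exact.
Qed.

Lemma birkhoffS g n x : birkhoff T g n.+1 x = birkhoff T g n x + g (iter n T x).
Proof. by rewrite /birkhoff big_ord_recr. Qed.

Lemma birkhoff_comp g n x :
  birkhoff T (g \o T) n x = birkhoff T g n x + (g (iter n T x) - g x).
Proof.
elim: n => [|n IH]; first by rewrite /birkhoff !big_ord0 /=; ring.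
by rewrite !birkhoffS IH /=; ring.
Qed.

Lemma continuous_birkhoff g n : continuous g -> continuous (birkhoff T g n).
Proof.
move=> cg; elim: n => [|n IH] x.
  rewrite (_ : birkhoff T g 0 = fun=> 0); first exact: cst_continuous.
  by apply/funext => y; rewrite /birkhoff big_ord0.
rewrite (_ : birkhoff T g n.+1 = birkhoff T g n \+ (g \o iter n T)).
  apply: (@continuousD R _ _ (birkhoff T g n) (g \o iter n T)); first exact: IH.
  by apply: continuous_comp; [exact: continuous_iter|exact: cg].
by apply/funext => y; rewrite birkhoffS.
Qed.

Lemma invariant_Rintegral mu g n : invariant_measures T mu -> continuous g ->
  'I_[mu] (g \o iter n T) = 'I_[mu] g.
Proof.
move=> inv cg; elim: n => // n IH.
have cgn : continuous (g \o iter n T).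
  by move=> x; apply: continuous_comp; [exact: continuous_iter|exact: cg].
have mT := map_measurable.
have [nu [nuE nuI]] := pushforward_probability cX mu mT.
rewrite -IH; transitivity ('I_[nu] (g \o iter n T)).
  by rewrite nuI//; congr ('I_[mu] _); apply/funext => x /=; rewrite -iterSr.
congr fine; apply: eq_measure_integral => A mA _.
exact: etrans (nuE A) (inv A mA).
Qed.

Lemma invariant_birkhoff mu g n : invariant_measures T mu -> continuous g ->
  'I_[mu] (birkhoff T g n) = n%:R * 'I_[mu] g.
Proof.
move=> inv cg; elim: n => [|n IH].
  rewrite mul0r -[RHS](Rintegral_cst1 mu); apply: eq_Rintegral => x _.
  by rewrite /birkhoff big_ord0.
have cgn : continuous (g \o iter n T).
  by move=> x; apply: continuous_comp; [exact: continuous_iter|exact: cg].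
rewrite (_ : birkhoff T g n.+1 = fun x => birkhoff T g n x + (g \o iter n T) x).
  rewrite RintegralD ?IH//; try apply: continuous_integrableX => //.
    by rewrite invariant_Rintegral// -natr1 mulrDl mul1r.
  exact: continuous_birkhoff.
by apply/funext => y; rewrite birkhoffS.
Qed.

(** Turns the limsup of sup norms into an eventual bound uniform in the point, which can be
    integrated or evaluated along an orbit. *)
Lemma AAP_approx Psi xi : AAP T Psi -> 0 < xi ->
  exists2 g : X -> R, continuous g & \forall n \near \oo, forall x,
    `|n%:R^-1 * Psi n x - n%:R^-1 * birkhoff T g n x| < xi.
Proof.
move=> [cPsi HPsi] xi0; have [g [cg]] := HPsi xi xi0.
(* The limsup is the infimum, over sets [V] of the filter, of suprema over [V]; one such supremum is
   already below [xi]. *)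
rewrite /limn_esup /limf_esup => /ereal_inf_lt[_ [V ooV <-] Vxi].
exists g => //; near=> n => x.
have n0 : (0 < n)%N by near: n; exists 1%N.
have Vn : V n by near: n.
have cD : continuous (fun x => Psi n x - birkhoff T g n x).
  move=> y; apply: (@continuousB R _ _ (Psi n) (birkhoff T g n)).
    exact: cPsi.
  exact: continuous_birkhoff.
(* The real supremum in [sup_norm] bounds its set once that set is known to be bounded, which
   compactness gives. *)
have [M [_ DM]] := continuous_bounded cX cD.
rewrite -mulrBr normrM ger0_norm ?invr_ge0//.
rewrite -lte_fin; apply: le_lt_trans Vxi.
apply: le_trans (_ : (n%:R^-1 * sup_norm (fun x => Psi n x - birkhoff T g n x))%:E
   <= _)%E; last by apply: ereal_sup_ubound; exists n.
rewrite lee_fin ler_wpM2l ?invr_ge0// /sup_norm; apply: ub_le_sup.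
  by exists M => _ [y _ <-].
by exists x.
Unshelve. all: by end_near. Qed.

Lemma AAP_mean_approx mu Psi g xi : AAP T Psi -> invariant_measures T mu ->
  continuous g ->
  (\forall n \near \oo, forall x,
    `|n%:R^-1 * Psi n x - n%:R^-1 * birkhoff T g n x| < xi) ->
  \forall n \near \oo, `|n%:R^-1 * 'I_[mu] (Psi n) - 'I_[mu] g| <= xi.
Proof.
move=> [cPsi _] inv cg Hg; near=> n.
have n0 : (0 < n)%N by near: n; exists 1%N.
have n0R : n%:R != 0 :> R by rewrite pnatr_eq0 -lt0n.
have cb := @continuous_birkhoff g n cg.
have -> : 'I_[mu] g = n%:R^-1 * 'I_[mu] (birkhoff T g n).
  by rewrite invariant_birkhoff// mulKf.
rewrite -!RintegralZl//; try apply: continuous_integrableX => //; last exact: cPsi.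
apply: (@Rintegral_dist_le _ _ cX mu (fun x => n%:R^-1 * Psi n x)
  (fun x => n%:R^-1 * birkhoff T g n x)) => //.
- by move=> x; apply: cvgM; [exact: cvg_cst|exact: cPsi].
- by move=> x; apply: cvgM; [exact: cvg_cst|exact: cb].
- by move=> x; apply/ltW; move: x; near: n.
Unshelve. all: by end_near. Qed.

(** The tail of the sequence stays within e of the integral of an approximant of precision e/2, so
    the sequence is Cauchy. *)
Lemma Fstar_cvg mu Psi : AAP T Psi -> invariant_measures T mu ->
  (fun n : nat => n%:R^-1 * 'I_[mu] (Psi n)) @ \oo --> Fstar Psi mu.
Proof.
move=> aP inv.
suff : cvg ((fun n : nat => n%:R^-1 * 'I_[mu] (Psi n)) @ \oo) by [].
apply/cauchy_cvgP/cauchy_exP => e e0.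
have [g cg Hg] := AAP_approx aP (divr_gt0 e0 (ltr0Sn R 1)).
exists ('I_[mu] g); have := AAP_mean_approx aP inv cg Hg.
apply: filterS => n; rewrite /= /ball/= distrC => H.
by apply: le_lt_trans H _; rewrite gtr_pMr// invf_lt1// ltr1n.
Qed.

Section EmpiricalLimit.
Context (G : set_system nat) {PG : ProperFilter G} (x : X) (mu : probability BX R).
Hypothesis Goo : \oo `<=` G.
Hypothesis Gmu : forall g, continuous g ->
  (fun n : nat => n%:R^-1 * birkhoff T g n x) @ G --> 'I_[mu] g.

(** The Birkhoff sums of [g \o T] and [g] differ by a telescoped boundary term of size at most 2M,
    negligible after division by n. The filter [G] is kept abstract so that the full sequence,
    subsequences and ultrafilters are all covered. *)
Lemma empirical_limit_invariant : invariant_measures T mu.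
Proof.
have mT := map_measurable.
have [nu [nuE nuI]] := pushforward_probability cX mu mT.
move=> A mA; rewrite -[LHS]nuE; apply: Borel_probability_unique => // g cg.
rewrite nuI//.
have cgT : continuous (g \o T).
  by move=> y; apply: continuous_comp; [exact: cT|exact: cg].
have [M [M0 gM]] := continuous_bounded cX cg.
apply: (cvg_unique _ (Gmu cgT)) => //.
rewrite (_ : (fun n : nat => _) = (fun n : nat => n%:R^-1 * birkhoff T g n x +
    n%:R^-1 * (g (iter n T x) - g x))); last first.
  by apply/funext => n; rewrite birkhoff_comp mulrDr.
rewrite -[Rintegral mu _ g]addr0; apply: cvgD; first exact: Gmu.
apply/cvgr0Pnorm_lt => e e0.
have /cvgr0Pnorm_lt /(_ _ (divr_gt0 e0 (mulr_gt0 (ltr0Sn R 1) M0))) :=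
  @cvg_inv_nat R.
move=> /Goo; apply: filterS => n; rewrite ltr_pdivlMr ?mulr_gt0// => ne.
apply: le_lt_trans ne; rewrite normrM ler_wpM2l//.
by rewrite (le_trans (ler_normB _ _))// mulr2n mulrDl mul1r lerD.
Qed.

(** Three errors of size e/3: from [Psi] to a Birkhoff sum at x, from the Birkhoff average to the
    integral along [G], and from that integral to [Fstar Psi mu]. *)
Lemma empirical_limit_AAP Psi : AAP T Psi ->
  (fun n : nat => n%:R^-1 * Psi n x) @ G --> Fstar Psi mu.
Proof.
move=> aP; have inv := empirical_limit_invariant.
apply/cvgrPdist_le => e e0.
have e3 : 0 < e / 3 by rewrite divr_gt0.
have [g cg Hg] := AAP_approx aP e3.
have Hm : `|Fstar Psi mu - 'I_[mu] g| <= e / 3.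
  have := AAP_mean_approx aP inv cg Hg.
  have /cvgrPdist_le := Fstar_cvg aP inv => H.
  (* This comparison runs along [\oo], where [Fstar] is defined, and not along [G]. *)
  move=> Hmean; apply/(@ler_addgt0Pl R) => d d0; near \oo => n.
  have H1 : `|Fstar Psi mu - n%:R^-1 * 'I_[mu] (Psi n)| <= d.
    by near: n; exact: H.
  have H2 : `|n%:R^-1 * 'I_[mu] (Psi n) - 'I_[mu] g| <= e / 3 by near: n.
  by rewrite (le_trans (ler_distD (n%:R^-1 * 'I_[mu] (Psi n)) _ _))// lerD.
have /cvgrPdist_le /(_ _ e3) HG := Gmu cg.
near=> n.
have H1 : `|n%:R^-1 * Psi n x - n%:R^-1 * birkhoff T g n x| < e / 3.
  by move: (x); near: n; exact: Goo.
have H2 : `|'I_[mu] g - n%:R^-1 * birkhoff T g n x| <= e / 3.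
  by near: n; exact: HG.
move: Hm H1 H2; rewrite !ler_norml ltr_norml; lra.
Unshelve. all: by end_near. Qed.

End EmpiricalLimit.
End AsymptoticallyAdditive.

(** * Representation of means by probabilities *)

(** Compactness is used as a near-covering property with the radius tending to 0 from the right as
    parameter: a radius that works near each point yields one that works everywhere. *)
Lemma compact_unif_continuous (R : realType) (X : pseudoPMetricType R)
    (g : X -> R) (e : R) : compact [set: X] -> continuous g -> 0 < e ->
  exists2 d : R, 0 < d & forall x y, ball x d y -> `|g x - g y| <= e.
Proof.
move=> /compact_near_coveringP cX cg e0.
have e20 : 0 < e / 2 by rewrite divr_gt0.
pose Q (d : R) x := forall y, ball x d y -> `|g x - g y| <= e.
have [x _|d /= d0 H] := cX R (0^'+) Q _; last first.
  exists (d / 2); first by rewrite divr_gt0.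
  move=> x; apply: (H (d / 2)) => //=; last by rewrite divr_gt0.
  by rewrite sub0r normrN gtr0_norm ?divr_gt0// ltr_pdivrMr// ltr_pMr// ltr1n.
have /cvgrPdist_le /(_ _ e20) := cg x.
rewrite /= -nbhs_ballE => -[r /= r0 Hr].
exists (ball x (r / 2), [set d | 0 < d < r / 2]).
  split; first exact: nbhsx_ballx (divr_gt0 r0 (ltr0Sn R 1)).
  near=> d; apply/andP; split=> //.
  by near: d; apply: nbhs_right_lt; rewrite divr_gt0.
move=> [x' d] [/= xx' /andP[d0 dr]] y x'y.
have Hx' : `|g x - g x'| <= e / 2.
  by apply: Hr; apply: le_ball xx'; rewrite ler_pdivrMr// ler_peMr ?ler1n ?ltW.
have Hy : `|g x - g y| <= e / 2.
  apply: Hr; rewrite [r]splitr; apply: ball_triangle xx' _.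
  by apply: le_ball x'y; exact: ltW.
rewrite (le_trans (ler_distD (g x) _ _))// [leRHS]splitr.
by rewrite lerD// distrC.
Unshelve. all: by end_near. Qed.

Lemma compact_finite_cover (X : ptopologicalType) (V : X -> set X) :
  compact [set: X] -> (forall x, open (V x)) -> (forall x, V x x) ->
  exists s : seq X, forall y, exists2 c, c \in s & V c y.
Proof.
rewrite compact_cover => cX oV Vx.
have [D' _ sD] := cX X setT V (fun i _ => oV i) (fun x _ => ex_intro2 _ _ x I (Vx x)).
by exists (finmap.enum_fset D') => y; have [c /= cD Vc] := sD y I; exists c.
Qed.

Section UniformMeasure.
Context (R : realType).
Local Notation P := (uniform_prob (@ltr01 R)).

Lemma uniform_prob01E (E : set R) : measurable E ->
  P E = lebesgue_measure (E `&` `[0, 1]).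
Proof.
move=> mE; have := @integral_uniform R 0 1 ltr01 (fun x => (\1_E x)%:E).
rewrite integral_indic// setIT subr0 invr1 mul1e => ->.
- by rewrite integral_indic.
- exact/measurable_EFinP.
- by move=> x; rewrite lee_fin.
Qed.

Lemma uniform_prob_itv (a b : R) : 0 <= a -> a <= b -> b <= 1 ->
  P `[a, b[ = (b - a)%:E.
Proof.
move=> a0 ab b1; rewrite uniform_prob01E//.
rewrite (_ : _ `&` _ = `[a, b[%classic); last first.
  apply/seteqP; split => t /=; rewrite !in_itv/=; lra.
rewrite lebesgue_measure_itv/= lte_fin; case: ltgtP ab => //.
by move=> ->; rewrite subrr.
Qed.
End UniformMeasure.

Definition bounded_real (R : realType) (X : Type) (h : X -> R) :=
  exists M : R, forall x, `|h x| <= M.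

(** The domain is all bounded functions, with no continuity or measurability, so that indicators of
    arbitrary sets have a mass. This mass is finitely additive; countable additivity will come from
    Lebesgue measure. *)
Definition is_mean (R : realType) (X : Type) (L : (X -> R) -> R) : Prop :=
  [/\ forall f g, bounded_real f -> bounded_real g ->
        L (fun x => f x + g x) = L f + L g,
      forall c f, bounded_real f -> L (fun x => c * f x) = c * L f,
      forall f g, bounded_real f -> bounded_real g ->
        (forall x, f x <= g x) -> L f <= L g
    & L (fun=> 1) = 1].

(** * Coding the atoms of a mean by subintervals of [0, 1) *)

Section Quantile.
Context (R : realType) (X : pseudoPMetricType R) (L : (X -> R) -> R).
Hypothesis cX : compact [set: X].
Hypothesis mL : is_mean L.
Local Notation BX := (@BorelX R X).
Local Notation P := (uniform_prob (@ltr01 R)).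

Definition mass (A : set X) : R := L (fun x => \1_A x).

Lemma bounded_indic (A : set X) : bounded_real (fun x => \1_A x : R).
Proof.
by exists 1 => x; rewrite indicE; case: (x \in A); rewrite ?normr1// normr0.
Qed.

Lemma bounded_mul (f g : X -> R) : bounded_real f -> bounded_real g ->
  bounded_real (fun x => f x * g x).
Proof.
by move=> [M fM] [N gN]; exists (M * N) => x; rewrite normrM ler_pM.
Qed.

Lemma bounded_cstM c (f : X -> R) : bounded_real f ->
  bounded_real (fun x => c * f x).
Proof. by move=> bf; apply: bounded_mul => //; exists `|c|. Qed.

Lemma mean_split (h : X -> R) (A B : set X) : bounded_real h ->
  L (fun x => h x * \1_A x) =
  L (fun x => h x * \1_(A `&` B) x) + L (fun x => h x * \1_(A `\` B) x).
Proof.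
move=> bh; case: mL => LD _ _ _.
rewrite -LD; try (apply: bounded_mul => //; exact: bounded_indic).
congr L; apply/funext => x; rewrite -mulrDr; congr (_ * _).
rewrite !indicE in_setI in_setD.
by case: (x \in A) (x \in B) => -[]; rewrite ?addr0 ?add0r.
Qed.

Lemma mass_split (A B : set X) : mass A = mass (A `&` B) + mass (A `\` B).
Proof.
have E C : L (fun x => 1 * \1_C x) = mass C.
  by congr L; apply/funext => x; rewrite mul1r.
by rewrite -!E; apply: mean_split; exists 1 => x; rewrite normr1.
Qed.

Lemma mass_ge0 A : 0 <= mass A.
Proof.
case: mL => _ LZ Lle _.
have <- : L (fun=> 0 * 1) = 0.
  by rewrite (LZ 0 (fun=> 1)) ?mul0r//; exists 1 => x; rewrite normr1.
apply: Lle; first by exists 0 => x; rewrite mul0r normr0.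
  exact: bounded_indic.
by move=> x; rewrite mul0r indicE.
Qed.

Lemma mass0 : mass set0 = 0.
Proof.
case: mL => _ LZ _ _; rewrite /mass.
rewrite (_ : (fun _ => _) = fun=> 0 * 1); last first.
  by apply/funext => x; rewrite indic0 mul0r.
by rewrite (LZ 0 (fun=> 1)) ?mul0r//; exists 1 => x; rewrite normr1.
Qed.

Lemma massT : mass setT = 1.
Proof.
case: mL => _ _ _ <-; congr L; apply/funext => x; rewrite indicT//.
Qed.

Lemma mean_local (h : X -> R) (A : set X) (c e : R) : bounded_real h ->
  (forall x, A x -> `|h x - c| <= e) ->
  `|L (fun x => h x * \1_A x) - c * mass A| <= e * mass A.
Proof.
move=> bh hc; case: mL => LD LZ Lle _.
have bA := bounded_indic A.
have K k : k * mass A = L (fun x => k * \1_A x) by rewrite LZ.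
rewrite ler_distl -mulrBl -mulrDl !K; apply/andP; split; apply: Lle;
  try exact: bounded_cstM; try exact: bounded_mul; move=> x;
  rewrite indicE; have [/set_mem/hc|] := boolP (x \in A); rewrite ?mulr0 ?mulr1//;
  rewrite ler_distl => /andP[]; lra.
Qed.

(* Nested-interval coding: the interval [a, a + mass A) is cut along the list
   into pieces whose lengths are the masses of the atoms generated by it, and
   [walk Bs A a t] is the atom whose piece contains t. *)
Fixpoint walk (Bs : seq (set X)) (A : set X) (a t : R) : set X :=
  if Bs is B :: Bs' then
    let q := a + mass (A `&` B) in
    if t < q then walk Bs' (A `&` B) a t else walk Bs' (A `\` B) q t
  else A.

Lemma walk_sub Bs A a t : walk Bs A a t `<=` A.
Proof.
elim: Bs A a => [|B Bs IH] A a x //=.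
by case: ifP => _ H; case: (IH _ _ _ H).
Qed.

Lemma walk_cat Bs Bs' A a t : exists a',
  walk (Bs ++ Bs') A a t = walk Bs' (walk Bs A a t) a' t.
Proof.
elim: Bs A a => [|B Bs IH] A a /=; first by exists a.
by case: ifP => _; exact: IH.
Qed.

(** The empty set has mass zero, so the half-open interval assigned to it contains no t. *)
Lemma walk_neq0 Bs A a t : a <= t < a + mass A -> walk Bs A a t !=set0.
Proof.
elim: Bs A a => [|B Bs IH] A a /=.
  move=> /andP[at1 ta]; apply/set0P; apply/eqP => A0.
  by move: ta; rewrite A0 mass0 addr0 ltNge at1.
rewrite (mass_split A B) addrA => /andP[at1 ta].
by case: ltP => tq; apply: IH; rewrite ?at1 ?tq ?ta.
Qed.

(** An atom outside every member of a cover would be empty, so some cut keeps the inside of a [B],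
    and all later atoms remain in that [B]. *)
Lemma walk_in_cover Bs A a t :
  (forall x, A x -> exists2 B, B \in Bs & B x) ->
  walk Bs A a t !=set0 -> exists2 B, B \in Bs & walk Bs A a t `<=` B.
Proof.
elim: Bs A a => [|B Bs IH] A a /= cov.
  by move=> [x /cov[]].
case: ifP => _ ne.
  by exists B; [rewrite mem_head|move=> x /walk_sub[]].
have [|B' B'Bs sub] := IH _ _ _ ne; last by exists B' => //; rewrite inE B'Bs orbT.
move=> x [Ax nBx]; have [B' + B'x] := cov x Ax; rewrite inE => /orP[/eqP B'B|B'Bs].
  by exfalso; apply: nBx; rewrite -B'B.
by exists B'.
Qed.

(** As a function of t the atom is a step function on finitely many intervals, hence [Q] can be an
    arbitrary predicate. *)
Lemma walk_measurable (Q : set X -> Prop) Bs A a :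
  measurable [set t : R | Q (walk Bs A a t)].
Proof.
elim: Bs A a => [|B Bs IH] A a /=.
  have [QA|nQ] := pselect (Q A).
    by rewrite (_ : [set _ | _] = setT)//; apply/seteqP; split.
  by rewrite (_ : [set _ | _] = set0)//; apply/seteqP; split.
set q := a + _.
rewrite (_ : [set _ | _] =
  (`]-oo, q[ `&` [set t | Q (walk Bs (A `&` B) a t)]) `|`
  (`[q, +oo[ `&` [set t | Q (walk Bs (A `\` B) q t)])); last first.
  apply/seteqP; split => t /=; rewrite !in_itv/= andbT.
    by case: ltP => tq; [left|right].
  by move=> [[tq]|[qt]]; rewrite ?tq// ltNge qt.
by apply: measurableU; apply: measurableI => //; exact: IH.
Qed.

(** Each interval has the Lebesgue length of its atom's mass, so the integral and the mean are
    compared atom by atom and the errors add up. On a final atom, both are compared with the value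
    of [h] at one of its points: the integral costs e, and the mean costs 2e because two values of
    [h] are compared through one value of [phi]. *)
Lemma walk_integral Bs A (a : R) (h : X -> R) (phi : R -> R) (M e : R) :
  bounded_real h -> measurable_fun setT phi -> (forall t, `|phi t| <= M) ->
  0 <= a -> a + mass A <= 1 ->
  (forall t x, a <= t < a + mass A -> walk Bs A a t x -> `|h x - phi t| <= e) ->
  `|Rintegral P `[a, a + mass A[ phi - L (fun x => h x * \1_A x)|
    <= (3 * e) * mass A.
Proof.
move=> bh mphi phiM; elim: Bs A a => [|B Bs IH] A a a0 aA1 H /=.
  (* A final atom of mass zero contributes nothing to either side: its interval is empty, and the
     mean of a bounded function over it vanishes. *)
  have := mass_ge0 A; rewrite le_eqVlt => /predU1P[A0|A0].
    have [N hN] := bh.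
    have := @mean_local h A 0 N bh.
    rewrite -A0 addr0 !mulr0 subr0 set_itvco0 ?Rintegral_set0 ?sub0r ?normrN//.
    by apply => x _; rewrite subr0.
  have aI t : a <= t < a + mass A -> `[a, a + mass A[%classic t.
    by rewrite /= in_itv.
  have [x0 Ax0] : A !=set0 by apply: (@walk_neq0 [::] A a a); rewrite lexx ltrDl.
  have PI : fine (P `[a, a + mass A[) = mass A.
    by rewrite uniform_prob_itv// ?lerDl ?mass_ge0//= addrAC subrr add0r.
  have iphi : P.-integrable `[a, a + mass A[ (EFin \o phi).
    by apply: (@bounded_integrable _ _ _ P _ phi M) => //; exact: measurable_funTS.
  have H1 : `|Rintegral P `[a, a + mass A[ phi - h x0 * mass A| <= e * mass A.
    rewrite -{2 3}PI; apply: Rintegral_local => // t; rewrite /= in_itv/= => tI.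
    by rewrite distrC; exact: H.
  have H2 : `|L (fun x => h x * \1_A x) - h x0 * mass A| <= 2 * e * mass A.
    apply: mean_local => // x Ax.
    have ha y : A y -> `|h y - phi a| <= e.
      by move=> Ay; apply: H => //; rewrite lexx ltrDl.
    rewrite (le_trans (ler_distD (phi a) _ _))// mulr_natl mulr2n.
    by rewrite lerD ?(ha _ Ax)// distrC ha.
  rewrite (le_trans (ler_distD (h x0 * mass A) _ _))//.
  rewrite (_ : 3 * e * mass A = e * mass A + 2 * e * mass A); last by ring.
  by rewrite lerD// distrC.
set q := a + mass (A `&` B).
have mA := mass_split A B.
have m1 := mass_ge0 (A `&` B); have m2 := mass_ge0 (A `\` B).
have E : a + mass A = q + mass (A `\` B) by rewrite mA /q addrA.
have aq : a <= q by rewrite lerDl.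
have qq : q <= a + mass A by rewrite E lerDl.
have iphi D : measurable D -> P.-integrable D (EFin \o phi).
  move=> mD; apply: (@bounded_integrable _ _ _ P _ phi M) => //.
  exact: measurable_funTS.
have -> : `[a, a + mass A[%classic = `[a, q[ `|` `[q, a + mass A[.
  by rewrite -itv_bndbnd_setU// bnd_simp.
rewrite Rintegral_setU//; last 2 first.
- by apply: iphi; exact: measurableU.
- apply/disj_setPS => t [] /=; rewrite !in_itv/= => /andP[_ tq] /andP[qt _].
  by move: tq; rewrite ltNge qt.
rewrite (mean_split _ B)// [in leRHS]mA.
have H1 := IH (A `&` B) a a0 (le_trans qq aA1).
have H2 := IH (A `\` B) q (le_trans a0 aq).
rewrite -/q in H1; rewrite -E in H2.
rewrite opprD addrACA (le_trans (ler_normD _ _))// mulrDr lerD//.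
  apply: H1 => t x /andP[at1 tq] Wx; apply: H; last by rewrite /= tq.
  by rewrite at1 (lt_le_trans tq).
apply: H2 => // t x /andP[qt ta] Wx; apply: H; last by rewrite /= ltNge qt.
by rewrite (le_trans aq qt).
Qed.

End Quantile.

(** * Riesz representation through a quantile map *)

Section Representation.
Context (R : realType) (X : pseudoPMetricType R) (L : (X -> R) -> R).
Hypothesis cX : compact [set: X].
Hypothesis mL : is_mean L.
Local Notation BX := (@BorelX R X).
Local Notation P := (uniform_prob (@ltr01 R)).

Lemma fine_covers : exists s : nat -> seq (set X), forall n,
  (forall x, exists2 B, B \in s n & B x) /\
  forall B, B \in s n -> forall x y, B x -> B y -> ball x (n.+1%:R^-1 : R) y.
Proof.
suff /choice[s sP] : forall n, exists s : seq (set X),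
    (forall x, exists2 B, B \in s & B x) /\
    forall B, B \in s -> forall x y, B x -> B y -> ball x (n.+1%:R^-1 : R) y.
  by exists s.
move=> n.
have r0 : 0 < (n.+1%:R^-1 / 2 : R) by rewrite divr_gt0// invr_gt0.
pose V (c : X) := interior (ball c (n.+1%:R^-1 / 2 : R)).
have [||s sV] := @compact_finite_cover X V cX.
- by move=> c; exact: open_interior.
- by move=> c; exact: nbhsx_ballx.
exists (map V s); split.
  by move=> x; have [c cs Vx] := sV x; exists (V c) => //; exact: map_f.
move=> _ /mapP[c _ ->] x y /interior_subset cx /interior_subset cy.
by rewrite [n.+1%:R^-1]splitr; apply: ball_triangle cy; exact: ball_sym.
Qed.

(** Cutting successively along finer and finer covers gives, for each t, decreasing nonempty atoms
    with diameters tending to zero; by compactness their closures have a common point, taken as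
    [Y t]. *)
Lemma quantile_map : exists (Y : R -> X) (W : nat -> seq (set X)),
  forall e : R, 0 < e -> exists n, forall t x, 0 <= t < 1 ->
    walk L (W n) setT 0 t x -> ball (Y t) e x.
Proof.
have [s sP] := fine_covers.
pose Bs n := flatten [seq s k | k <- iota 0 n].
pose W n t := walk L (Bs n) setT 0 t.
have BsS n : Bs n.+1 = Bs n ++ s n.
  by rewrite /Bs -addn1 iotaD map_cat flatten_cat /= cats0.
have WS n t : W n.+1 t `<=` W n t.
  rewrite /W BsS; have [a' ->] := walk_cat L (Bs n) (s n) setT 0 t.
  exact: walk_sub.
have Wle n m t : (n <= m)%N -> W m t `<=` W n t.
  move=> /subnK <-; elim: (m - n)%N => [//|k IH]; rewrite addSn.
  exact: subset_trans (WS _ _) IH.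
have Wne n (t : R) : 0 <= t < 1 -> W n t !=set0.
  by move=> t01; apply: walk_neq0; rewrite // add0r massT.
have Wsmall n t x y : 0 <= t < 1 -> W n.+1 t x -> W n.+1 t y ->
    ball x (n.+1%:R^-1 : R) y.
  move=> /(Wne n.+1 t); rewrite /W BsS.
  have [a' ->] := walk_cat L (Bs n) (s n) setT 0 t => ne Wx Wy.
  have [|B Bs' sub] := walk_in_cover _ ne; last first.
    by apply: (sP n).2 Bs' _ _ _ _; exact: sub.
  by move=> z _; exact: (sP n).1.
have Yex t : 0 <= t < 1 -> exists y, forall n, closure (W n t) y.
  move=> t01.
  have PF : ProperFilter (filter_from setT (fun n => W n t)).
    apply: filter_from_proper; last by move=> n _; exact: Wne.
    apply: filter_from_filter; first by exists 0%N.
    move=> i j _ _; exists (maxn i j) => // z Wz.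
    by split; apply: Wle Wz; rewrite ?leq_maxl ?leq_maxr.
  have [|y [_ cy]] := cX PF; first exact: filterT.
  by exists y => n U yU; apply: cy => //; exists n.
have /choice[Y YP] : forall t, exists y, 0 <= t < 1 -> forall n, closure (W n t) y.
  move=> t; have [/Yex[y yP]|nt] := boolP (0 <= t < 1); first by exists y.
  by exists point.
exists Y, Bs => e e0.
have [n ne] : exists n, (n.+1%:R^-1 : R) < e / 2.
  near \oo => n; exists n; near: n.
  exact: near_infty_natSinv_lt (PosNum (divr_gt0 e0 (ltr0Sn R 1))).
exists n.+1 => t x t01 Wx.
have [x' [Wx' Yx']] : W n.+1 t `&` ball (Y t) (e / 2) !=set0.
  by apply: YP => //; apply: nbhsx_ballx; rewrite divr_gt0.
rewrite [e]splitr; apply: ball_triangle Yx' _.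
by apply: le_ball (Wsmall _ _ _ _ t01 Wx' Wx); exact: ltW.
Unshelve. all: by end_near. Qed.

Lemma mean_representation : exists mu : probability BX R,
  forall g : X -> R, continuous g -> Rintegral mu [set: BX] g = L g.
Proof.
have [Y0 [W Y0P]] := quantile_map.
pose I01 : set R := `[0, 1[%classic.
have mI : measurable I01 by exact: measurable_itv.
(* Outside [0, 1) the map [Y0] is uncontrolled; a constant value there makes measurability hold on
   the whole line. *)
pose Y (t : R) := if 0 <= t < 1 then Y0 t else point.
have YP (e : R) : 0 < e -> exists n, forall (t : R) x, 0 <= t < 1 ->
    walk L (W n) setT 0 t x -> ball (Y t) e x.
  move=> /Y0P[n nP]; exists n => t x t01; rewrite /Y t01; exact: nP.
have Wne n (t : R) : 0 <= t < 1 -> walk L (W n) setT 0 t !=set0.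
  by move=> t01; apply: walk_neq0; rewrite // add0r massT.
have /choice[N NP] : forall k, exists n, forall (t : R) x, 0 <= t < 1 ->
    walk L (W n) setT 0 t x -> ball (Y t) (k.+1%:R^-1 : R) x.
  by move=> k; apply: YP; rewrite invr_gt0.
have mY : measurable_fun [set: R] (Y : R -> BX).
  apply: (@measurability _ _ _ BX setT Y (@open X) erefl) => _ [U oU <-].
  rewrite setTI.
  (* On [0, 1), [Y t] lies in [U] exactly when, for some k, the k-th chosen atom of t has its whole
     neighbourhood of radius 1/(k+1) in [U]. This is a countable union of sets described by
     atoms. *)
  pose Q k (A : set X) := forall x, A x -> ball x (k.+1%:R^-1 : R) `<=` U.
  rewrite (_ : Y @^-1` U =
    (I01 `&` \bigcup_k [set t | Q k (walk L (W (N k)) setT 0 t)]) `|`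
    (~` I01 `&` [set t | U point])); last first.
    apply/seteqP; split => t; rewrite /I01 /= in_itv/=.
      have [t01 YU|nt] := boolP (0 <= t < 1); last by rewrite /Y (negbTE nt); right.
      left; split => //.
      have := oU; rewrite openE => /(_ _ YU); rewrite /interior -nbhs_ballE.
      move=> -[r /= r0 rU].
      have [k kr] : exists k, (k.+1%:R^-1 : R) < r / 2.
        near \oo => k; exists k; near: k.
        exact: near_infty_natSinv_lt (PosNum (divr_gt0 r0 (ltr0Sn R 1))).
      exists k => // x Wx z xz; apply: rU; rewrite [r]splitr.
      apply: (@ball_triangle _ _ x).
        by apply: le_ball (NP _ _ _ t01 Wx); exact: ltW.
      by apply: le_ball xz; exact: ltW.
    move=> [[t01 [k _ Qk]]|[/negP nt Up]]; last by rewrite /Y (negbTE nt).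
    have [x Wx] := Wne (N k) _ t01.
    by apply: (Qk x Wx); apply: ball_sym; exact: NP.
  apply: measurableU; apply: measurableI => //.
  - by apply: bigcupT_measurable => k; exact: walk_measurable.
  - exact: measurableC.
  - have [Up|nUp] := pselect (U point).
      by rewrite (_ : [set _ | _] = setT)//; apply/seteqP; split.
    by rewrite (_ : [set _ | _] = set0)//; apply/seteqP; split.
have [mu [muE muI]] := pushforward_probability cX P mY.
exists mu => g cg; rewrite muI//.
have [M [M0 gM]] := continuous_bounded cX cg.
have bg : bounded_real g by exists M.
have mgY : measurable_fun setT (g \o Y).
  have mg := continuous_measurableX cg.
  have : measurable_fun setT ((g : BX -> R) \o Y) by exact: measurableT_comp.
  by [].
have igY D : measurable D -> P.-integrable D (EFin \o (g \o Y)).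
  move=> mD; apply: (@bounded_integrable _ _ _ P _ (g \o Y) M) => //.
    exact: measurable_funTS.
  by move=> t; exact: gM.
have ->: Rintegral P setT (g \o Y) = Rintegral P I01 (g \o Y).
  rewrite -(setUv I01) Rintegral_setU//; last 3 first.
  - exact: measurableC.
  - by rewrite setUv; exact: igY.
  - by apply/disj_setPCl.
  have PC : P (~` I01) = 0%E.
    have PI : P I01 = 1%E by rewrite /I01 uniform_prob_itv// subr0.
    by apply: etrans (probability_setC P mI) _; rewrite [X in (_ - X)%E]PI subee.
  have := @Rintegral_local _ _ _ P (~` I01) (g \o Y) 0 M.
  rewrite ![X in fine X](_ : _ = 0%E)// /= !mulr0 subr0 normr_le0 => H.
  rewrite (eqP (H _ _ _)) ?addr0//.
  - exact: measurableC.
  - by apply: igY; exact: measurableC.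
  - by move=> t _; rewrite subr0; exact: gM.
suff H (e : R) : 0 < e -> `|Rintegral P I01 (g \o Y) - L g| <= e.
  apply/eqP; rewrite -subr_eq0 -normr_le0; apply/ler_addgt0Pl => e e0.
  by rewrite addr0; exact: H.
move=> e0; have e3 : 0 < e / 3 by rewrite divr_gt0.
have [d d0 dP] := compact_unif_continuous cX cg e3.
have [n nP] := YP d d0.
have := @walk_integral R X L mL (W n) setT 0 g (g \o Y) M (e / 3) bg mgY _ (lexx 0).
rewrite massT// add0r => H.
rewrite (_ : L g = L (fun x => g x * \1_setT x)); last first.
  by congr L; apply/funext => x; rewrite indicT mulr1.
apply: le_trans (H _ _ _) _ => //.
- by move=> t; exact: gM.
- by move=> t x t01 Wx; rewrite distrC; apply: dP; exact: nP.
- by rewrite mulr1 mulrC divfK.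
Unshelve. all: by end_near. Qed.

End Representation.

(** * Generic points of invariant measures *)

Section BirkhoffSums.
Context (R : realType) (X : pseudoPMetricType R) (T : X -> X).
Implicit Types (h : X -> R).

Lemma birkhoff0 h x : birkhoff T h 0 x = 0.
Proof. by rewrite /birkhoff big_ord0. Qed.

Lemma birkhoffD h m n x :
  birkhoff T h (m + n) x = birkhoff T h m x + birkhoff T h n (iter m T x).
Proof.
elim: n => [|n IH]; first by rewrite addn0 birkhoff0 addr0.
by rewrite addnS !birkhoffS IH -addrA -iterD addnC.
Qed.

Lemma birkhoff_norm_le h n x (K : R) : (forall y, `|h y| <= K) ->
  `|birkhoff T h n x| <= K * n%:R.
Proof.
move=> hK; elim: n => [|n IH]; first by rewrite birkhoff0 normr0 mulr0.
by rewrite birkhoffS (le_trans (ler_normD _ _))// -natr1 mulrDr mulr1 lerD.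
Qed.

Lemma birkhoff_shadow h n x y (e : R) :
  (forall p, (p < n)%N -> `|h (iter p T x) - h (iter p T y)| <= e) ->
  `|birkhoff T h n x - birkhoff T h n y| <= e * n%:R.
Proof.
elim: n => [|n IH] H; first by rewrite !birkhoff0 subr0 normr0 mulr0.
rewrite !birkhoffS opprD addrACA (le_trans (ler_normD _ _))//.
rewrite -natr1 mulrDr mulr1 lerD ?H//.
by apply: IH => p pn; apply: H; exact: ltnW.
Qed.

End BirkhoffSums.

(** * Quadrature by finitely many points *)

Section Sampling.
Context (R : realType) (X : pseudoPMetricType R).
Hypothesis cX : compact [set: X].
Local Notation BX := (@BorelX R X).

(** The cover is made disjoint along the list, each piece giving its measure as weight and the
    centre c as node. Nodes and weights do not depend on [h]; the set [D] is general because the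
    induction removes [V c] from it. *)
Lemma quadrature_weights (mu : probability BX R) (V : X -> set X) (cs : seq X)
    (D : set X) : (forall c, open (V c)) -> measurable (D : set BX) ->
  (forall x, D x -> exists2 c, c \in cs & V c x) ->
  exists w : seq (R * X),
    \sum_(p <- w) p.1 = fine (mu D) /\
    all (fun p => 0 <= p.1) w /\
    forall (h : X -> R) (e : R), continuous h ->
      (forall c x, V c x -> `|h x - h c| <= e) ->
      `|Rintegral mu D h - \sum_(p <- w) p.1 * h p.2| <= e * fine (mu D).
Proof.
move=> oV; elim: cs D => [|c cs IH] D mD cov.
  exists [::]; have -> : D = set0 by apply/seteqP; split => // x /cov[].
  split; first by rewrite big_nil measure0.
  by split=> // h e _ _; rewrite big_nil Rintegral_set0 subr0 normr0 measure0 mulr0.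
have mV : measurable (V c : set BX) by exact: open_measurableX.
have m1 : measurable ((D `&` V c) : set BX) by exact: measurableI.
have m2 : measurable ((D `\` V c) : set BX) by exact: measurableD.
have [|w [w1 [w0 wh]]] := IH _ m2.
  move=> x [/cov[c' + Vx] nV]; rewrite inE => /orP[/eqP cc|cs'].
    by exfalso; apply: nV; rewrite -cc.
  by exists c'.
have muD : fine (mu D) = fine (mu (D `&` V c)) + fine (mu (D `\` V c)).
  rewrite -fineD ?fin_num_measure// -measureU//; last first.
    by apply/seteqP; split => // x [[_ ?] [_]].
  by rewrite setUIDK.
exists ((fine (mu (D `&` V c)), c) :: w); split; first by rewrite big_cons w1 muD.
split; first by rewrite /= w0 andbT fine_ge0.
move=> h e ch He; rewrite big_cons /= muD mulrDr.
have ih (E : set BX) : measurable E -> mu.-integrable E (EFin \o h).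
  by move=> mE; apply: integrableS (continuous_integrableX cX mu ch).
have -> : Rintegral mu D h =
    Rintegral mu (D `&` V c) h + Rintegral mu (D `\` V c) h.
  rewrite -Rintegral_setU//; last 2 first.
  - by apply: ih; exact: measurableU.
  - by apply/disj_setPS => x [[_ ?] [_]].
  by rewrite setUIDK.
rewrite opprD addrACA (le_trans (ler_normD _ _))// lerD ?wh//.
rewrite [_ * h c]mulrC; apply: Rintegral_local => //; first exact: ih.
by move=> x [_]; exact: He.
Qed.

(** Each node c of weight a is repeated as often as the integer part of K a. Every rounding errs by
    at most 1, so the total error does not grow with [K]. *)
Lemma rounded_counts (w : seq (R * X)) (K : R) : 0 <= K ->
  all (fun p => 0 <= p.1) w ->
  exists Y : seq X, forall (h : X -> R) (B : R), (forall x, `|h x| <= B) ->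
    `|\sum_(y <- Y) h y - K * \sum_(p <- w) p.1 * h p.2| <= (size w)%:R * B.
Proof.
move=> K0; elim: w => [|[a c] w IH] /=.
  by move=> _; exists [::] => h B _; rewrite !big_nil mulr0 subr0 normr0 mul0r.
move=> /andP[a0 /IH[Y YP]]; exists (nseq (Num.truncn (K * a)) c ++ Y) => h B hB.
rewrite big_cat big_nseq big_cons /= iter_addr_0 mulrDr opprD addrACA.
rewrite (le_trans (ler_normD _ _))// -[(size w).+1]add1n natrD mulrDl mul1r.
rewrite lerD ?YP// -mulr_natl mulrA -mulrBl normrM.
rewrite -[leRHS]mul1r ler_pM// distrC.
have /Num.Theory.truncn_itv/andP[t1 t2] : 0 <= K * a by rewrite mulr_ge0.
by rewrite ger0_norm ?subr_ge0// lerBlDr nat1r ltW.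
Qed.

End Sampling.

(** * Sampling an invariant measure by orbit segments *)

Section Approximation.
Context (R : realType) (X : pseudoPMetricType R) (T : X -> X).
Hypothesis cX : compact [set: X].
Hypothesis cT : continuous T.
Local Notation BX := (@BorelX R X).
Variable mu : probability BX R.
Hypothesis inv : invariant_measures T mu.

(** The class of test functions over which estimates are uniform: sample points and shadowing orbits
    must be fixed before the test function is known. *)
Definition osc_le (d e : R) (g : X -> R) : Prop :=
  [/\ continuous g, forall x, `|g x| <= 1 &
      forall x y, ball x d y -> `|g x - g y| <= e].

Definition centered (g : X -> R) (x : X) : R :=
  g x - Rintegral mu [set: BX] g.

Local Notation dev g := (birkhoff T (centered g)).

Lemma centered_norm_le g x : continuous g -> (forall x, `|g x| <= 1) ->
  `|centered g x| <= 2.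
Proof.
move=> cg g1; rewrite (le_trans (ler_normB _ _))// (_ : 2 = 1 + 1 :> R)// lerD//.
exact: Rintegral_norm_le.
Qed.

Lemma continuous_centered g : continuous g -> continuous (centered g).
Proof. by move=> cg x; apply: cvgB; [exact: cg|exact: cvg_cst]. Qed.

Lemma centeredB g x y : centered g x - centered g y = g x - g y.
Proof. by rewrite /centered opprB addrA subrK. Qed.

Lemma dev_Rintegral0 g n : continuous g ->
  Rintegral mu [set: BX] (dev g n) = 0.
Proof.
move=> cg; rewrite (invariant_birkhoff cX cT n inv (continuous_centered cg)).
rewrite RintegralB//; try exact: continuous_integrableX.
  by rewrite Rintegral_cst1 subrr mulr0.
by apply: (@continuous_integrableX _ _ cX mu (cst _)) => x; exact: cst_continuous.
Qed.

Lemma bowen_nbhs (d : R) (N : nat) (c : X) : 0 < d ->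
  \forall x \near c, forall i, (i < N)%N -> ball (iter i T c) d (iter i T x).
Proof.
move=> d0; elim: N => [|N IH]; first exact: nearW.
have H : \forall x \near c, ball (iter N T c) d (iter N T x).
  exact: (@continuous_iter R X T cT N c _ (nbhsx_ballx (iter N T c) d d0)).
near=> x => i; rewrite ltnS leq_eqVlt => /orP[/eqP->|iN]; first by near: x.
by move: i iN; near: x.
Unshelve. all: by end_near. Qed.

(* [dev g N] has mu-integral 0 by invariance, so a quadrature of it by the
   points of Y, uniform in g, is small. *)
Lemma sampled_points (d : R) (N : nat) : 0 < d <= 1 ->
  exists Y : seq X, (0 < size Y)%N /\ forall e g, d <= e -> osc_le d e g ->
    `|\sum_(y <- Y) dev g N y| <= 4 * e * N%:R * (size Y)%:R.
Proof.
move=> /andP[d0 d1].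
pose V c := interior [set x | forall i, (i < N)%N ->
  ball (iter i T c) d (iter i T x)].
have oV c : open (V c) by exact: open_interior.
have Vc c : V c c by exact: bowen_nbhs.
have [cs csV] := compact_finite_cover cX oV Vc.
have [w [w1 [w0 wh]]] := @quadrature_weights R X cX mu V cs setT oV measurableT
  (fun x _ => csV x).
rewrite (probability_setT mu) /= in w1 wh.
(* The rounding error r is to be at most d times the sample size. Testing the counts on the constant
   1 gives a size of at least K - r = u, and u is chosen so that r <= d u and u > 0. *)
pose r : R := (size w)%:R; pose u := r / d + 1; pose K := u + r.
have r0 : 0 <= r by rewrite ler0n.
have u0 : 0 < u by rewrite ltr_wpDl// divr_ge0// ltW.
have rdu : r <= d * u.
  by rewrite mulrDr mulr1 mulrC divfK ?gt_eqF// lerDl ltW.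
have K0 : 0 <= K by rewrite addr_ge0// ltW.
have [Y YP] := rounded_counts K0 w0.
have us : u <= (size Y)%:R.
  have E1 : \sum_(y <- Y) 1 = (size Y)%:R :> R.
    by rewrite big_const_seq count_predT iter_addr_0.
  have E2 : \sum_(p <- w) p.1 * 1 = 1 :> R.
    by rewrite -[RHS]w1; apply: eq_bigr => p _; rewrite mulr1.
  have := YP (fun=> 1) 1; rewrite E1 E2 !mulr1 -/r ler_distl /K => H.
  have /H /andP[+ _] : forall x : X, `|1 : R| <= 1 by move=> _; rewrite normr1.
  by rewrite addrK.
exists Y; split; first by rewrite -(ltr0n R) (lt_le_trans u0).
move=> e g de [cg g1 gd].
have e0 : 0 < e by exact: lt_le_trans de.
have cd : continuous (dev g N).
  by apply: continuous_birkhoff => //; exact: continuous_centered.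
have hB x : `|dev g N x| <= 2 * N%:R.
  by apply: birkhoff_norm_le => y; exact: centered_norm_le.
have hV c x : V c x -> `|dev g N x - dev g N c| <= e * N%:R.
  move=> /interior_subset Vx; apply: birkhoff_shadow => p pN.
  by rewrite centeredB distrC; apply: gd; exact: Vx.
have H1 := YP _ _ hB; have := wh _ _ cd hV.
rewrite dev_Rintegral0// sub0r normrN mulr1 => H2.
have N0 : 0 <= N%:R :> R by rewrite ler0n.
have rNe : r * N%:R <= e * u * N%:R.
  by rewrite ler_wpM2r// (le_trans rdu)// ler_wpM2r// ltW.
have ruN : r * N%:R <= u * N%:R.
  rewrite ler_wpM2r// (le_trans rdu)// -[leRHS]mul1r ler_wpM2r// ltW//.
have H3 : `|K * \sum_(p <- w) p.1 * dev g N p.2| <= K * (e * N%:R).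
  by rewrite normrM ger0_norm// ler_wpM2l.
apply: (@le_trans _ _ (4 * e * N%:R * u)); last first.
  by rewrite ler_wpM2l// !mulr_ge0// ltW.
rewrite -[X in `|X|](subrK (K * \sum_(p <- w) p.1 * dev g N p.2)).
rewrite (le_trans (ler_normD _ _))// (le_trans (lerD H1 H3))//.
rewrite -/r /K (_ : r * (2 * N%:R) + (u + r) * (e * N%:R) =
  2 * (r * N%:R) + e * (u * N%:R) + e * (r * N%:R)); last by ring.
rewrite (_ : 4 * e * N%:R * u = 2 * (e * u * N%:R) + e * (u * N%:R)
   + e * (u * N%:R)); last by ring.
by rewrite !lerD// ler_wpM2l// ltW.
Qed.

End Approximation.

(** * Orbits with small deviation over a finite horizon *)

Section AlmostGeneric.
Context (R : realType) (X : pseudoPMetricType R) (T : X -> X).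
Hypothesis cX : compact [set: X].
Hypothesis cT : continuous T.
Hypothesis spec : specification T.
Variable mu : probability (@BorelX R X) R.
Hypothesis inv : invariant_measures T mu.
Local Notation dev g := (birkhoff T (centered mu g)).

Lemma dev_norm_le (d e : R) g n x : osc_le d e g -> `|dev g n x| <= 2 * n%:R.
Proof. by case=> cg g1 _; apply: birkhoff_norm_le => y; exact: centered_norm_le. Qed.

Lemma dev_shadow (d e : R) g n x y : osc_le d e g ->
  (forall p, (p < n)%N -> ball (iter p T x) d (iter p T y)) ->
  `|dev g n x - dev g n y| <= e * n%:R.
Proof.
case=> _ _ gd H; apply: birkhoff_shadow => p pn.
by rewrite centeredB; apply: gd; exact: H.
Qed.

(** The segments of length [N] issued from [Y] are prescribed cyclically, one every N + m steps.
    Only the prescribed pattern is periodic, not the orbit of z. *)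
Lemma periodic_shadowing (d : R) : 0 < d -> exists m, forall N (Y : seq X) k,
  (0 < N)%N -> exists z, forall j p, (j < k)%N -> (p < N)%N ->
    ball (iter p T (nth point Y (j %% size Y))) d (iter (p + j * (N + m)) T z).
Proof.
move=> /spec[m mP]; exists m => N Y k N0.
have [||z zP] := mP k (fun j => j * (N + m))%N (fun j => j * (N + m) + N.-1)%N
  (fun j => nth point Y (j %% size Y)).
- by move=> j _; rewrite leq_addr.
- by move=> j _; rewrite mulSn [leqRHS]addnC -addnA leq_add2l leq_add2r leq_pred.
exists z => j p jk pN; apply: zP => //.
by rewrite addKn -ltnS prednK.
Qed.

(** Over a full cycle through the sample the deviation nearly equals the sampled sum, which is
    small. The constant 9 is 1 for shadowing, 2 for gaps, 4 for sampling and 2 for an incomplete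
    last cycle. Specification handles finitely many segments, whence the horizon [K]; the waiting
    time [n0] is independent of it. *)
Lemma almost_generic_point (d : R) : 0 < d <= 1 -> exists n0, forall K, exists w,
  forall n, (n0 <= n <= K)%N -> forall e g, d <= e -> osc_le d e g ->
    `|dev g n w| <= 9 * e * n%:R.
Proof.
move=> /[dup] d01 /andP[d0 d1]; have [m mP] := periodic_shadowing d0.
pose N := (Num.truncn (m%:R / d)).+1.
have mdN : m%:R <= d * N%:R.
  rewrite mulrC -ler_pdivrMr// ltW// /N.
  by have /andP[] := Num.Theory.truncn_itv (divr_ge0 (ler0n R m) (ltW d0)).
have [Y [Y0 YP]] := sampled_points cX cT inv N d01.
pose M := size Y; pose Q := (N + m)%N; pose P := (M * Q)%N.
have P0 : (0 < P)%N by rewrite muln_gt0 Y0.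
pose n0 := (Num.truncn (P%:R / d)).+1.
have Pdn : P%:R <= d * n0%:R.
  rewrite mulrC -ler_pdivrMr// ltW// /n0.
  by have /andP[] := Num.Theory.truncn_itv (divr_ge0 (ler0n R P) (ltW d0)).
exists n0 => K; have [z zP] := mP N Y (K * M)%N isT.
exists z => n /andP[n0n nK] e g de og.
have e0 : 0 < e by exact: lt_le_trans de.
have block j : (j < K * M)%N ->
    `|dev g Q (iter (j * Q) T z) - dev g N (nth point Y (j %% M))| <=
    3 * e * N%:R.
  move=> jK; rewrite /Q birkhoffD -addrA [_ + (- _)]addrC addrA.
  rewrite (le_trans (ler_normD _ _))//.
  rewrite (_ : 3 * e * N%:R = e * N%:R + 2 * (e * N%:R)); last by ring.
  apply: lerD.
    rewrite distrC; apply: (dev_shadow og) => p pN.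
    by rewrite -iterD; exact: zP.
  rewrite (le_trans (dev_norm_le _ _ og))// ler_wpM2l//.
  by rewrite (le_trans mdN)// ler_wpM2r.
have period q : (q < K)%N -> `|dev g P (iter (q * P) T z)| <= 7 * e * P%:R.
  move=> qK.
  (* Comparison before taking absolute values: the sampled deviations cancel only when summed over
     the whole of [Y]. *)
  have partial i : (i <= M)%N -> `|dev g (i * Q) (iter (q * P) T z) -
      \sum_(j < i) dev g N (nth point Y j)| <= (3 * e * N%:R) * i%:R.
    elim: i => [|i IH] iM.
      by rewrite mul0n birkhoff0 big_ord0 subr0 normr0 mulr0.
    rewrite mulSnr birkhoffD big_ord_recr /= opprD addrACA -[i.+1%:R]natr1 mulrDr mulr1.
    rewrite (le_trans (ler_normD _ _))// lerD ?IH ?(ltnW iM)//.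
    have := block (q * M + i)%N _.
    have -> : ((q * M + i) * Q = i * Q + q * P)%N.
      by rewrite mulnDl -mulnA addnC.
    rewrite iterD modnMDl modn_small//; apply.
    rewrite (@leq_trans (q.+1 * M))// ?leq_mul2r ?qK ?orbT//.
    by rewrite mulSnr ltn_add2l.
  have := partial M (leqnn M); rewrite -/P => H.
  have HY := YP e g de og; rewrite (big_nth point) big_mkord -/M in HY.
  rewrite -[X in `|X|](subrK (\sum_(j < M) dev g N (nth point Y j))).
  rewrite (le_trans (ler_normD _ _))// (le_trans (lerD H HY))//.
  rewrite (_ : 3 * e * N%:R * M%:R + 4 * e * N%:R * M%:R =
    7 * e * (M * N)%:R); last by rewrite natrM; ring.
  by rewrite ler_wpM2l ?mulr_ge0 ?ler_nat ?leq_mul2l ?leq_addr ?orbT// ltW.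
have periods q : (q <= K)%N -> `|dev g (q * P) z| <= 7 * e * P%:R * q%:R.
  elim: q => [|q IH] qK; first by rewrite mul0n birkhoff0 normr0 mulr0.
  rewrite mulSnr birkhoffD -[q.+1%:R]natr1 mulrDr mulr1 (le_trans (ler_normD _ _))//.
  by rewrite lerD ?IH ?period// ltnW.
have qK : (n %/ P <= K)%N by rewrite (leq_trans (leq_div _ _)).
rewrite {1}(divn_eq n P) birkhoffD (le_trans (ler_normD _ _))//.
rewrite (_ : 9 * e * n%:R = 7 * e * n%:R + 2 * (e * n%:R)); last by ring.
apply: lerD.
  rewrite (le_trans (periods _ qK))// -mulrA -natrM ler_wpM2l//.
    by rewrite mulr_ge0// ltW.
  by rewrite ler_nat mulnC leq_trunc_div.
rewrite (le_trans (dev_norm_le _ _ og))// ler_wpM2l//.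
apply: (@le_trans _ _ P%:R); first by rewrite ler_nat ltnW// ltn_mod.
rewrite (le_trans Pdn)// ler_pM// ?ler_nat//; exact: ltW.
Qed.

End AlmostGeneric.

(** * Gluing finite orbits into a generic point *)

Section GenericPoint.
Context (R : realType) (X : pseudoPMetricType R) (T : X -> X).
Hypothesis cX : compact [set: X].
Hypothesis cT : continuous T.
Hypothesis spec : specification T.
Variable mu : probability (@BorelX R X) R.
Hypothesis inv : invariant_measures T mu.
Local Notation dev g := (birkhoff T (centered mu g)).
Local Notation dyad k := ((2 ^+ k%N)^-1 : R).

Lemma dyad_gt0 k : 0 < dyad k. Proof. by rewrite invr_gt0 exprn_gt0. Qed.

Lemma dyadS k : dyad k = dyad k.+1 + dyad k.+1.
Proof. by rewrite exprS invfM -mulrDl; lra. Qed.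

Lemma dyad_le k l : (k <= l)%N -> dyad l <= dyad k.
Proof.
by move=> kl; rewrite lef_pV2 ?posrE ?exprn_gt0// ler_weXn2l// ler1n.
Qed.

Lemma shadow_two k : exists m : nat, forall (z w : X) (t n : nat), (0 < t)%N ->
  exists z', (forall p, (p < t)%N -> ball (iter p T z) (dyad k) (iter p T z')) /\
    forall p, (p < n)%N ->
      ball (iter p T w) (dyad k) (iter p T (iter (t + m) T z')).
Proof.
have [m mP] := spec (dyad_gt0 k); exists m => z w t n t0.
have [||z' zP] := mP 2 (fun j => if j == 0 then 0 else t + m)%N
  (fun j => if j == 0 then t.-1 else t + m + n)%N
  (fun j => if j == 0%N then z else w).
- by move=> [|[|j]]//= _; rewrite leq_addr.
- by move=> [|j]//= _; rewrite leq_add2r leq_pred.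
exists z'; split=> p pt.
  have := zP 0%N isT p; rewrite /= subn0 addn0; apply.
  by rewrite -ltnS prednK.
rewrite -iterD; have := zP 1%N isT p; rewrite /= addKn; apply.
exact: ltnW.
Qed.

(* Stage k replaces the current orbit after time t k by that of w k; the dyadic
   tolerances are summable, and t k dominates the waiting time n0 k and the gap
   m k, so that every initial segment, not only those ending a stage, has small
   deviation. *)
Lemma glued_point : exists (x : X) (t m n0 : nat -> nat) (w : nat -> X),
  [/\ forall k, (0 < t k)%N,
      forall k, (2 * t k <= t k.+1)%N,
      forall k, (n0 k + m k)%:R <= dyad k * (t k)%:R,
      forall k n, (n0 k <= n <= t k.+1)%N -> forall e g, dyad k <= e ->
        osc_le (dyad k) e g -> `|dev g n (w k)| <= 9 * e * n%:R
    & forall k p, (t k + m k + p < t k.+1)%N ->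
        ball (iter p T (w k)) (3 * dyad k) (iter p T (iter (t k + m k) T x))].
Proof.
have dyad01 k : 0 < dyad k <= 1.
  by rewrite dyad_gt0 invf_le1 ?exprn_gt0// exprn_ege1// ler1n.
have /choice[n0 /choice[w0 n0P]] :
    forall k, exists n0, exists w0 : nat -> X, forall K n, (n0 <= n <= K)%N ->
      forall e g, dyad k <= e -> osc_le (dyad k) e g ->
    `|dev g n (w0 K)| <= 9 * e * n%:R.
  move=> k; have [n0 n0P] := almost_generic_point cX cT spec inv (dyad01 k).
  by have /choice[w0 w0P] := n0P; exists n0, w0.
have /choice[m mP] := shadow_two.
(* Since [c k <= t k], the waiting time and the gap together are at most the fraction 2^-k of
   [t k]. *)
pose c k := (2 ^ k * (n0 k + m k))%N.
pose t := fix t k := if k is k'.+1 then (2 * t k' + (1 + c k'.+1))%N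
                     else (1 + c 0)%N.
have tS k : t k.+1 = (2 * t k + (1 + c k.+1))%N by [].
have t0 k : (0 < t k)%N by case: k => [|k]//; rewrite tS addnA addn1.
have ct k : (c k <= t k)%N.
  case: k => [|k]; first by rewrite /= leq_addl.
  by rewrite tS addnCA addnA leq_addl.
have t2 k : (2 * t k <= t k.+1)%N by rewrite tS leq_addr.
have tle k l : (k <= l)%N -> (t k <= t l)%N.
  move=> /subnK <-; elim: (l - k)%N => [//|d IH]; rewrite addSn.
  by rewrite (leq_trans IH)// (leq_trans _ (t2 _))// leq_pmull.
(* The horizon of [w k] is the end of stage k, already known because the times do not depend on the
   points. *)
pose w k := w0 k (t k.+1).
have /choice[f fP] : forall kz : nat * X, exists z',
    (forall p, (p < t kz.1)%N -> ball (iter p T kz.2) (dyad kz.1) (iter p T z')) /\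
    forall p, (p < t kz.1.+1)%N -> ball (iter p T (w kz.1)) (dyad kz.1)
       (iter p T (iter (t kz.1 + m kz.1) T z')).
  by move=> [k z]; exact: mP.
pose z := fix z k := if k is k'.+1 then f (k', z k') else point.
have zS k : z k.+1 = f (k, z k) by [].
(* The tolerances 2^-k, ..., 2^-(k+d) of the successive replacements sum to exactly 2 * 2^-k -
   2^-(k+d). *)
have zz k i d : (i < t k)%N ->
    ball (iter i T (z k)) (2 * dyad k - dyad (k + d)) (iter i T (z (k + d.+1)%N)).
  move=> it; elim: d => [|d IH].
    rewrite addnS !addn0 (_ : 2 * dyad k - dyad k = dyad k); last by ring.
    by apply: (fP (k, z k)).1.
  rewrite (_ : 2 * dyad k - dyad (k + d.+1) =
    2 * dyad k - dyad (k + d) + dyad (k + d.+1)); last first.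
    by rewrite [dyad (k + d)]dyadS -addnS; ring.
  apply: ball_triangle IH _; rewrite [(k + d.+2)%N]addnS zS.
  apply: (fP ((k + d.+1)%N, z (k + d.+1)%N)).1.
  by rewrite (leq_trans it)//= tle// leq_addr.
have [x [_ cx]] : [set: X] `&` cluster (z @ \oo) !=set0.
  by apply: cX; exact: filterT.
exists x, t, m, n0, w; split => //.
- move=> k; rewrite mulrC ler_pdivlMr ?exprn_gt0//.
  by rewrite -natrX -natrM ler_nat mulnC ct.
- by move=> k n; exact: n0P.
- move=> k p kp; set q := (t k + m k)%N in kp *.
  have q1 : (p + q < t k.+1)%N by rewrite addnC.
  have Hw : ball (iter p T (w k)) (dyad k) (iter p T (iter q T (z k.+1))).
    by apply: (fP (k, z k)).2; rewrite (leq_ltn_trans _ q1)// leq_addr.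
  have Nx : nbhs x [set y | ball (iter (p + q) T x) (dyad k.+1) (iter (p + q) T y)].
    exact: (@continuous_iter R X T cT (p + q) x _ (nbhsx_ballx _ _ (dyad_gt0 _))).
  (* As x is a cluster point, some late stage is close to it at the time considered, and one such
     stage suffices. *)
  have [y [[d _ <-]]] : [set z (k.+1 + d.+1)%N | d in [set: nat]] `&`
      [set y | ball (iter (p + q) T x) (dyad k.+1) (iter (p + q) T y)] !=set0.
    apply: cx Nx; exists k.+2 => // j /= kj.
    by exists (j - k.+2)%N => //; rewrite addnS -[in RHS](subnKC kj).
  rewrite /= => xz.
  (* The path goes from [w k] to stage k+1, from there to the late stage, and from that to x; one
     [dyad k.+1] is slack. *)
  rewrite (_ : 3 * dyad k = dyad k + (2 * dyad k.+1 + dyad k.+1) + dyad k.+1); last first.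
    by rewrite dyadS; ring.
  apply: (ball_triangle _ (ball_sym _)); last first.
    by rewrite -iterD; exact: xz.
  apply: ball_triangle Hw _.
  rewrite -!iterD; apply: le_ball (zz k.+1 (p + q)%N d q1).
  by rewrite lerD// lerNl (le_trans _ (ltW (dyad_gt0 _)))// oppr_le0 ltW// dyad_gt0.
Qed.

Lemma dyad_small (e : R) : 0 < e -> exists k0, forall k, (k0 <= k)%N -> dyad k <= e.
Proof.
move=> e0; have [n ne] : exists n, (n.+1%:R^-1 : R) < e.
  near \oo => n; exists n; near: n.
  exact: near_infty_natSinv_lt (PosNum e0).
exists n => k nk; rewrite (le_trans (dyad_le nk))// (le_trans _ (ltW ne))//.
by rewrite lef_pV2 ?posrE ?exprn_gt0// -natrX ler_nat ltn_expl.
Unshelve. all: by end_near. Qed.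

Lemma osc_leW (d d' e : R) (g : X -> R) : d' <= d -> osc_le d e g -> osc_le d' e g.
Proof.
by move=> dd [cg g1 gd]; split=> // y z yz; apply: gd; exact: le_ball yz.
Qed.

(** The point is fixed before [g] and e; [C] absorbs the early stages, whose tolerances are still
    too coarse for them. Later stages are chained one after another, and the bound at the end of a
    stage feeds the next one. *)
Lemma glued_dev_bound : exists x, forall g : X -> R, continuous g ->
  (forall y, `|g y| <= 1) -> forall e : R, 0 < e ->
  exists C, forall n, `|dev g n x| <= C + 14 * e * n%:R.
Proof.
have [x [t [m [n0 [w [t0 t2 nm wP sh]]]]]] := glued_point.
exists x => g cg g1 e e0.
have [d d0 gd] := compact_unif_continuous cX cg e0.
have od : osc_le d e g by [].
have [k1 k1P] := dyad_small e0.
(* The glued orbit shadows [w k] within 3 * 2^-k, which must not exceed the modulus d. *)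
have [k2 k2P] := dyad_small (divr_gt0 d0 (ltr0Sn R 2)).
pose k0 := maxn k1 k2.
have dle k : (k0 <= k)%N -> dyad k <= e.
  by rewrite geq_max => /andP[/k1P].
have od3 k : (k0 <= k)%N -> osc_le (3 * dyad k) e g.
  rewrite geq_max => /andP[_ /k2P dk]; apply: osc_leW od.
  by rewrite mulrC -ler_pdivlMr.
have od1 k : (k0 <= k)%N -> osc_le (dyad k) e g.
  move=> /od3; apply: osc_leW; rewrite ler_peMl ?ltW ?dyad_gt0// ltr1n//.
have tR k : 0 <= (t k)%:R :> R by rewrite ler0n.
have nR k : 0 <= k%:R :> R by rewrite ler0n.
(* Shadowing costs e and the deviation of [w k] costs 9e per step; the gap and the waiting time are
   charged to the past, as 2e per step before [t k]. *)
have stage k n : (k0 <= k)%N -> (t k + n <= t k.+1)%N ->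
    `|dev g n (iter (t k) T x)| <= 10 * e * n%:R + 2 * e * (t k)%:R.
  move=> kk tn.
  have nme : (n0 k)%:R + (m k)%:R <= e * (t k)%:R.
    by rewrite -natrD (le_trans (nm k))// ler_wpM2r// dle.
  have [nmk|/ltnW mkn] := leqP n (m k).
    rewrite (le_trans (dev_norm_le T cX mu n _ od))// -[leLHS]add0r lerD//.
      by rewrite !mulr_ge0// ltW.
    rewrite -mulrA ler_wpM2l// (le_trans _ nme)// -[leLHS]add0r lerD//.
    by rewrite ler_nat.
  have [r nE] : exists r, n = (m k + r)%N by exists (n - m k)%N; rewrite subnKC.
  move: tn; rewrite nE addnA birkhoffD -iterD [(m k + t k)%N]addnC => tr.
  have Hm := dev_norm_le T cX mu (m k) (iter (t k) T x) od.
  have Hs : `|dev g r (iter (t k + m k) T x) - dev g r (w k)| <= e * r%:R.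
    rewrite distrC; apply: (dev_shadow mu (od3 k kk)) => p pr; apply: sh.
    by rewrite (leq_trans _ tr)// ltn_add2l.
  have Hw : `|dev g r (w k)| <= 9 * e * r%:R + 2 * (n0 k)%:R.
    have [nr|/ltnW rn] := leqP (n0 k) r.
      rewrite (le_trans (wP k r _ e g _ _)) ?dle ?lerDl ?mulr_ge0//; last exact: od1.
      by rewrite nr (leq_trans _ tr)// leq_addl.
    rewrite (le_trans (dev_norm_le T cX mu r _ od))// -[leLHS]add0r lerD//.
      by rewrite !mulr_ge0// ltW.
    by rewrite ler_wpM2l// ler_nat.
  rewrite (le_trans (ler_normD _ _))//.
  rewrite -[X in _ + `|X|](subrK (dev g r (w k))).
  rewrite (le_trans (lerD Hm (le_trans (ler_normD _ _) (lerD Hs Hw))))//.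
  rewrite (_ : 2 * (m k)%:R + _ =
    10 * e * r%:R + 2 * ((n0 k)%:R + (m k)%:R)); last by ring.
  apply: lerD; last by rewrite -mulrA ler_wpM2l.
  by rewrite ler_wpM2l ?mulr_ge0 ?ler_nat ?leq_addl// ltW.
pose C : R := 2 * (t k0)%:R.
(* A complete stage is at least as long as its past, so the charge 2e moves onto the new steps and
   10 becomes 12 without accumulating. *)
have atT k : (k0 <= k)%N -> `|dev g (t k) x| <= C + 12 * e * (t k)%:R.
  move=> /subnK <-; elim: (k - k0)%N => [|l IH].
    rewrite add0n (le_trans (dev_norm_le T cX mu _ _ od))// lerDl.
    by rewrite !mulr_ge0// ltW.
  rewrite addSn; set k' := (l + k0)%N in IH *.
  have [r rE] : exists r, t k'.+1 = (t k' + r)%N.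
    exists (t k'.+1 - t k')%N; rewrite subnKC//.
    by rewrite (leq_trans _ (t2 _))// leq_pmull.
  have tr : (t k' <= r)%N.
    by rewrite -(leq_add2l (t k')) -rE addnn -mul2n.
  have St := stage k' r (leq_addl _ _); rewrite -rE leqnn in St.
  rewrite rE birkhoffD (le_trans (ler_normD _ _))//.
  rewrite (le_trans (lerD IH (St isT)))//.
  rewrite natrD (_ : C + _ + _ = C + 12 * e * (t k')%:R + 10 * e * r%:R
    + 2 * e * (t k')%:R); last by ring.
  rewrite (_ : C + 12 * e * ((t k')%:R + r%:R) = C + 12 * e * (t k')%:R
    + 10 * e * r%:R + 2 * e * r%:R); last by ring.
  by rewrite lerD2l ler_wpM2l ?mulr_ge0 ?ler_nat// ltW.
exists C => n.
(* Inside an incomplete stage the charge 2e stays on the past, which turns 12 into 14. *)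
have upto l n' : (n' <= t (l + k0))%N -> `|dev g n' x| <= C + 14 * e * n'%:R.
  elim: l n' => [|l IH] n' nt.
    rewrite (le_trans (dev_norm_le T cX mu _ _ od))//.
    rewrite -[leLHS]addr0 lerD ?mulr_ge0//; last exact: ltW.
    by rewrite ler_wpM2l// ler_nat.
  have [/IH//|/ltnW tn] := leqP n' (t (l + k0)).
  have [r rE] : exists r, n' = (t (l + k0) + r)%N.
    by exists (n' - t (l + k0))%N; rewrite subnKC.
  have St := stage (l + k0)%N r (leq_addl _ _).
  rewrite -rE in St; have {}St := St nt.
  rewrite rE birkhoffD (le_trans (ler_normD _ _))//.
  rewrite (le_trans (lerD (atT (l + k0)%N (leq_addl _ _)) St))//.
  rewrite natrD (_ : C + 14 * e * ((t (l + k0)%N)%:R + r%:R) =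
    C + 12 * e * (t (l + k0)%N)%:R + (10 * e * r%:R + 2 * e * (t (l + k0)%N)%:R)
    + 4 * e * r%:R); last by ring.
  by rewrite lerDl !mulr_ge0// ltW.
apply: (upto n); elim: n => [//|n IH].
by rewrite addSn (leq_trans _ (t2 _))// mul2n -addnn -addn1 leq_add.
Qed.

(** With e/28 in place of e, the linear term gives e/2 after division by n and C/n takes the other
    half. A general [g] is rescaled by a bound to reach the unit case. *)
Lemma generic_point : exists x, forall g : X -> R, continuous g ->
  (fun n : nat => n%:R^-1 * birkhoff T g n x) @ \oo -->
    Rintegral mu [set: @BorelX R X] g.
Proof.
have [x xP] := glued_dev_bound; exists x.
have devE g n : (0 < n)%N -> n%:R^-1 * dev g n x =
    n%:R^-1 * birkhoff T g n x - Rintegral mu [set: @BorelX R X] g.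
  move=> n0; rewrite (_ : dev g n x = birkhoff T g n x -
    n%:R * Rintegral mu [set: @BorelX R X] g).
    by rewrite mulrBr mulKf// pnatr_eq0 -lt0n.
  rewrite /birkhoff mulr_natl -[n in _ *+ n](card_ord n) -sumr_const -sumrB.
  by [].
have unit_case g : continuous g -> (forall y, `|g y| <= 1) ->
    (fun n : nat => n%:R^-1 * birkhoff T g n x) @ \oo -->
    Rintegral mu [set: @BorelX R X] g.
  move=> cg g1; apply/cvgrPdist_le => e e0.
  have [C CP] := xP g cg g1 _ (divr_gt0 e0 (ltr0Sn R 27)).
  have C0 : 0 <= C.
    by have := CP 0%N; rewrite birkhoff0 normr0 mulr0 addr0.
  have C1 : 0 < C + 1 by rewrite ltr_wpDl.
  have /cvgr0Pnorm_lt /(_ _ (divr_gt0 (divr_gt0 e0 (ltr0Sn R 1)) C1)) :=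
    @cvg_inv_nat R.
  move=> H; near=> n.
  have n0 : (0 < n)%N by near: n; exists 1%N.
  have n0R : 0 < n%:R :> R by rewrite ltr0n.
  have Hn : `|n%:R^-1 : R| < e / 2 / (C + 1) by near: n.
  rewrite ger0_norm ?invr_ge0 ?ler0n// in Hn.
  rewrite distrC -devE// normrM ger0_norm ?invr_ge0 ?ler0n//.
  rewrite ler_pdivrMl// (le_trans (CP n))//.
  rewrite (_ : n%:R * e = e / 2 * n%:R + 14 * (e / 28) * n%:R); last by field.
  rewrite lerD2r; move: Hn; rewrite ltr_pdivlMr// ltr_pdivrMl// [n%:R * _]mulrC => Hn.
  by rewrite (le_trans _ (ltW Hn))// lerDl.
move=> g cg; have [M [M0 gM]] := continuous_bounded cX cg.
have cgM : continuous (fun y => M^-1 * g y).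
  by move=> y; apply: cvgM; [exact: cvg_cst|exact: cg].
have gM1 y : `|M^-1 * g y| <= 1.
  by rewrite normrM ger0_norm ?invr_ge0 ?(ltW M0)// ler_pdivrMl// mulr1.
have M0' : M != 0 by rewrite gt_eqF.
rewrite (_ : (fun n : nat => _) = fun n : nat =>
    M * (n%:R^-1 * birkhoff T (fun y => M^-1 * g y) n x)); last first.
  apply/funext => n; rewrite /birkhoff -mulr_sumr.
  by rewrite [n%:R^-1 * (M^-1 * _)]mulrCA mulVKf.
rewrite (_ : Rintegral mu _ g = M * Rintegral mu [set: @BorelX R X]
    (fun y => M^-1 * g y)); last first.
  by rewrite RintegralZl//; [rewrite mulVKf|exact: continuous_integrableX].
by apply: cvgM; [exact: cvg_cst|exact: unit_case].
Unshelve. all: by end_near. Qed.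

End GenericPoint.

(** * Level sets *)

(** A bounded image has a cluster point, and a cluster point of an ultrafilter is a limit. *)
Lemma ultrafilter_cvg (R : realType) (S : Type) (U : set_system S) (u : S -> R)
    (M : R) : UltraFilter U -> (forall s, `|u s| <= M) -> cvg (u @ U).
Proof.
move=> UU uM; have [p [_ cp]] : `[- M, M]%classic `&` cluster (u @ U) !=set0.
  apply: segment_compact; apply: (@filterS _ U _ setT); last exact: filterT.
  by move=> s _; rewrite /= in_itv/= -ler_norml.
apply/cvg_ex; exists p => V Vp.
have [//|nV] := in_ultra_setVsetC (u @^-1` V) UU.
by have [y [ny /ny]] := cp (~` V) V nV Vp.
Qed.

(** * Ultralimits of empirical averages *)

Section EmpiricalMean.
Context (R : realType) (X : pseudoPMetricType R) (T : X -> X) (x : X).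
Context (U : set_system nat) (UU : UltraFilter U).
Hypothesis Uoo : \oo `<=` U.

Definition empirical_mean (h : X -> R) : R :=
  lim ((fun n : nat => n%:R^-1 * birkhoff T h n x) @ U).

Lemma empirical_mean_cvg (h : X -> R) : bounded_real h ->
  (fun n : nat => n%:R^-1 * birkhoff T h n x) @ U --> empirical_mean h.
Proof.
move=> [M hM]; have M0 : 0 <= M by rewrite (le_trans _ (hM x)).
suff : cvg ((fun n : nat => n%:R^-1 * birkhoff T h n x) @ U) by [].
apply: (@ultrafilter_cvg _ _ _ _ M) => -[|n].
  by rewrite birkhoff0 mulr0 normr0.
rewrite normrM ger0_norm ?invr_ge0// ler_pdivrMl ?ltr0n// mulrC.
exact: birkhoff_norm_le.
Qed.

Lemma empirical_mean_is_mean : is_mean empirical_mean.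
Proof.
split.
- move=> f g bf bg; apply: cvg_lim => //.
  rewrite (_ : (fun n : nat => _) = fun n : nat => n%:R^-1 * birkhoff T f n x +
      n%:R^-1 * birkhoff T g n x).
    by apply: cvgD; exact: empirical_mean_cvg.
  by apply/funext => n; rewrite /birkhoff big_split/= mulrDr.
- move=> c f bf; apply: cvg_lim => //.
  rewrite (_ : (fun n : nat => _) = fun n : nat =>
      c * (n%:R^-1 * birkhoff T f n x)).
    by apply: cvgM; [exact: cvg_cst|exact: empirical_mean_cvg].
  by apply/funext => n; rewrite /birkhoff -mulr_sumr mulrCA.
- move=> f g bf bg fg; apply: ler_lim.
  + by apply/cvg_ex; eexists; exact: empirical_mean_cvg.
  + by apply/cvg_ex; eexists; exact: empirical_mean_cvg.
  + apply: nearW => n; rewrite ler_wpM2l ?invr_ge0//.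
    by apply: ler_sum => i _.
(* At n = 0 the average of 1 is 0, so the hypothesis that [U] contains the cofinite sets is what
   gives 1 here. *)
- apply: cvg_lim => //; apply: cvg_near_cst; apply: Uoo; exists 1%N => // n /= n0.
  rewrite /birkhoff sumr_const card_ord mulVf// pnatr_eq0.
  by rewrite -lt0n.
Qed.

End EmpiricalMean.

Lemma ereal_real_between (R : realType) (a b : \bar R) :
  (a < b)%E -> exists r : R, (a < r%:E)%E /\ (r%:E < b)%E.
Proof.
case: a => [a||]; case: b => [b||] //=.
- rewrite lte_fin => ab; exists ((a + b) / 2); rewrite !lte_fin; lra.
- by move=> _; exists (a + 1); rewrite lte_fin ltrDl ltry.
- by move=> _; exists (b - 1); rewrite ltNyr lte_fin gtrBl.
- by move=> _; exists 0; rewrite ltNyr ltry.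
Qed.

(** * Comparing limit points, limsups and the constrained supremum *)

Section LevelSets.
Context (R : realType) (X : pseudoPMetricType R) (T : X -> X).
Hypothesis cX : compact [set: X].
Hypothesis cT : continuous T.
Implicit Types (F Phi : nat -> X -> R) (alpha : R).

Lemma exists_generic_in_level F Phi alpha (mu : probability (@BorelX R X) R) :
  specification T -> AAP T F -> AAP T Phi ->
  invariant_measures T mu -> Fstar Phi mu = alpha ->
  exists x, [/\ level_set Phi alpha x, limit_points T x mu &
    limn_esup (fun n : nat => (n%:R^-1 * F n x)%:E) = (Fstar F mu)%:E].
Proof.
move=> spec aF aP inv <-; have [x xmu] := generic_point cX cT spec inv.
exists x; split.
- exact: (empirical_limit_AAP cX cT _ xmu aP).
- by exists id.
- have H : (fun n : nat => (n%:R^-1 * F n x)%:E) @ \oo --> (Fstar F mu)%:E.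
    apply: cvg_EFin; first exact: nearW.
    exact: (empirical_limit_AAP cX cT _ xmu aF).
  rewrite is_cvg_limn_esupE; first exact: cvg_lim H.
  by apply/cvg_ex; eexists; exact: H.
Qed.

(** A strictly increasing phi pushes [\oo] to a finer filter, so the results on empirical limits
    apply, and uniqueness of limits identifies [Fstar Phi mu]. *)
Lemma limit_point_in_level Phi alpha x (mu : probability (@BorelX R X) R) :
  AAP T Phi -> level_set Phi alpha x -> limit_points T x mu ->
  invariant_measures T mu /\ Fstar Phi mu = alpha.
Proof.
move=> aP xK [phi [phiS phiP]].
have phi_ge k : (k <= phi k)%N.
  by elim: k => // k IH; exact: leq_ltn_trans (phiS k).
have phioo : \oo `<=` fmap phi \oo.
  move=> A [N _ NA]; exists N => // k /= Nk.
  by apply: NA; exact: leq_trans (phi_ge k).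
have muP g : continuous g -> (fun n : nat => n%:R^-1 * birkhoff T g n x) @
    fmap phi \oo --> Rintegral mu [set: @BorelX R X] g by exact: phiP.
have PF : ProperFilter (fmap phi \oo) by exact: fmap_proper_filter.
have inv := @empirical_limit_invariant R X T cX cT _ PF x mu phioo muP.
have cP := @empirical_limit_AAP R X T cX cT _ PF x mu phioo muP Phi aP.
split=> //; apply: (@cvg_unique R _ _ (fmap_proper_filter _ PF) _ _ cP) => //.
by apply: cvg_trans xK; exact: cvg_app.
Qed.

Lemma limn_esup_le_Lambda F Phi alpha x : AAP T F -> AAP T Phi ->
  level_set Phi alpha x ->
  (limn_esup (fun n : nat => (n%:R^-1 * F n x)%:E) <= Lambda T F Phi alpha)%E.
Proof.
move=> aF aP xK; rewrite leNgt; apply/negP => /ereal_real_between[a [La aL]].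
pose V := [set n : nat | a <= n%:R^-1 * F n x].
have PF : ProperFilter (filter_from \oo (fun A : set nat => A `&` V)).
  apply: filter_from_proper.
    apply: filter_from_filter; first by exists setT; exact: filterT.
    move=> A B ooA ooB; exists (A `&` B); first exact: filterI.
    by move=> n [[An Bn] Vn].
  move=> A ooA; apply: contrapT => /set0P/negP/negPn/eqP AV0.
  move: aL; rewrite ltNge => /negP; apply.
  (* If a set [A] of the filter missed [V], the supremum over [A] would be at most a, hence so would
     the limsup. *)
  apply: le_trans (ereal_inf_lbound _) _; first by exists A => //; reflexivity.
  apply: ub_ereal_sup => _ [n An <-]; rewrite lee_fin leNgt; apply/negP => an.
  suff : (A `&` V) n by rewrite AV0.
  by split=> //; exact: ltW.
(* The ultrafilter makes all bounded averages converge at once while keeping the values of F at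
   least a. *)
have [U [UU subU]] := ultraFilterLemma PF.
have PU : ProperFilter U by exact: ultra_proper.
have Uoo : \oo `<=` U.
  by move=> A ooA; apply: subU; exists A => // n [].
have UV : U V by apply: subU; exists setT; [exact: filterT|move=> n []].
have [mu muL] := mean_representation cX (empirical_mean_is_mean T x UU Uoo).
have muP g : continuous g ->
    (fun n : nat => n%:R^-1 * birkhoff T g n x) @ U --> Rintegral mu setT g.
  move=> cg; rewrite muL//; apply: empirical_mean_cvg.
  by have [M [_ gM]] := continuous_bounded cX cg; exists M.
have inv := @empirical_limit_invariant R X T cX cT U PU x mu Uoo muP.
have cF := @empirical_limit_AAP R X T cX cT U PU x mu Uoo muP F aF.
have cP := @empirical_limit_AAP R X T cX cT U PU x mu Uoo muP Phi aP.
have muA : Fstar Phi mu = alpha.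
  apply: (@cvg_unique R _ _ (fmap_proper_filter _ PU) _ _ cP) => //.
  by apply: cvg_trans xK; exact: cvg_app.
have aF' : a <= Fstar F mu.
  rewrite -(cvg_lim _ cF)//; apply: limr_ge; last exact: UV.
  by apply/cvg_ex; eexists; exact: cF.
move: La; rewrite ltNge => /negP; apply.
apply: le_trans (ereal_sup_ubound _); last by exists mu.
by rewrite lee_fin.
Qed.

End LevelSets.

Theorem theoremC (R : realType) (X : pseudoPMetricType R) (T : X -> X)
  (F Phi : nat -> X -> R) (alpha : R) :
  hausdorff_space X -> compact [set: X] -> continuous T ->
  specification T -> AAP T F -> AAP T Phi ->
  (eta_pot T Phi <= alpha%:E <= beta_pot T Phi)%E ->
  Lambda T F Phi alpha =
    ereal_sup [set limn_esup (fun n : nat => ((n%:R)^-1 * F n x)%:E)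
              | x in level_set Phi alpha]
  /\
  Lambda T F Phi alpha =
    ereal_sup [set (Fstar F mu)%:E
              | mu in [set mu | exists2 x, level_set Phi alpha x &
                                           limit_points T x mu]].
Proof.
move=> _ cX cT spec aF aP _; split; apply/le_anti/andP; split.
- apply: ub_ereal_sup => _ [mu [inv muA] <-].
  have [x [xK _ <-]] := exists_generic_in_level cX cT spec aF aP inv muA.
  by apply: ereal_sup_ubound; exists x.
- by apply: ub_ereal_sup => _ [x xK <-]; exact: limn_esup_le_Lambda.
- apply: ub_ereal_sup => _ [mu [inv muA] <-].
  have [x [xK xmu _]] := exists_generic_in_level cX cT spec aF aP inv muA.
  by apply: ereal_sup_ubound; exists mu => //; exists x.
- apply: ub_ereal_sup => _ [mu [x xK xmu] <-]; apply: ereal_sup_ubound.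
  by exists mu => //; exact: limit_point_in_level xmu.
Qed.
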